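(* Let $1<p<\infty$ with $p\ne 2$ and let $C<\infty$. Suppose that for each $s=1,2,\dots$ the positive integer $k_s$ satisfies $$\pi_p(u)<C\,\pi_p^{(k_s)}(u)$$ for all nonzero bounded linear operators $u$ between Banach spaces having rank at most $s$. Then for all $K<\infty$, $$k_s\,s^{-K}\to\infty\quad\text{as } s\to\infty.$$
   Context: For a bounded linear operator $u:X\to Y$ between Banach spaces, $1\le p<\infty$ and a positive integer $m$, $\pi_p^{(m)}(u)$ is the least constant $c\ge 0$ such that $$\Bigl(\sum_{i=1}^m\|u x_i\|^p\Bigr)^{1/p}\le c\,\sup\Bigl\{\Bigl(\sum_{i=1}^m|x^*(x_i)|^p\Bigr)^{1/p}: x^*\in X^*,\ \|x^*\|\le 1\Bigr\}$$ for all $x_1,\dots,x_m\in X$. The $p$-summing norm is $\pi_p(u)=\sup_m\pi_p^{(m)}(u)$. *)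

(* Defs.v *)
From HB Require Import structures.
From mathcomp Require Import all_boot all_order all_algebra.
From mathcomp Require Import complex.
From mathcomp Require Import all_classical all_reals all_analysis.
Import Order.TTheory GRing.Theory Num.Theory.
Import numFieldNormedType.Exports.

Set Implicit Arguments.
Unset Strict Implicit.
Unset Printing Implicit Defensive.

Local Open Scope classical_set_scope.
Local Open Scope ring_scope.

(* Banach spaces are taken over either of the two usual scalar fields; a Banach
   space over F is a [completeNormedModType (scalar_field R F)]. *)
Inductive scalars := RealScalars | ComplexScalars.

Definition scalar_field (R : realType) (F : scalars) : numFieldType :=
  match F with
  | RealScalars => (R : numFieldType)
  | ComplexScalars => (R[i] : numFieldType)
  end.

(* The norm of a normed space over [scalar_field R F] has its values in the
   scalar field (for complex scalars: in the nonnegative reals of R[i]);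
   [real_value] reads such a value as an element of R. *)
Definition real_value (R : realType) (F : scalars) : scalar_field R F -> R :=
  match F return scalar_field R F -> R with
  | RealScalars => fun a => a
  | ComplexScalars => fun a => complex.Re a
  end.

Section Operators.
Variables (R : realType) (F : scalars).
Local Notation K := (scalar_field R F).
Implicit Types X Y : normedModType K.

Definition rnorm X (x : X) : R := real_value `|x|.

Definition bounded_operator X Y (u : {linear X -> Y}) : Prop :=
  exists M : R, forall x : X, rnorm (u x) <= M * rnorm x.

Definition operator_norm X Y (u : {linear X -> Y}) : \bar R :=
  ereal_sup [set (rnorm (u x))%:E | x in [set x : X | rnorm x <= 1]].

Definition rank_at_most X Y (s : nat) (u : {linear X -> Y}) : Prop :=
  exists v : 'I_s -> Y,
    range u = [set \sum_(i < s) a i *: v i | a in [set: 'I_s -> K]].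

Definition dual_unit_ball X : set {linear X -> K^o} :=
  [set f | bounded_operator f /\ (operator_norm f <= 1)%E].

Definition lp_norm (p : R) X (m : nat) (x : 'I_m -> X) : R :=
  (\sum_(i < m) rnorm (x i) `^ p) `^ p^-1.

Definition weak_lp_norm (p : R) X (m : nat) (x : 'I_m -> X) : \bar R :=
  ereal_sup [set (lp_norm p (fun i => f (x i)))%:E | f in @dual_unit_ball X].

Definition pi_summing_m (p : R) (m : nat) X Y (u : {linear X -> Y}) : \bar R :=
  ereal_inf [set c%:E | c in [set c : R | 0 <= c /\
    forall x : 'I_m -> X,
      ((lp_norm p (fun i => u (x i)))%:E <= c%:E * weak_lp_norm p x)%E]].

Definition pi_summing (p : R) X Y (u : {linear X -> Y}) : \bar R :=
  ereal_sup [set pi_summing_m p m u | m in [set m : nat | (0 < m)%N]].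

End Operators.

(* Main.v *)
Require Import Defs.
From HB Require Import structures.
From mathcomp Require Import all_boot all_order all_algebra.
From mathcomp Require Import cyclic separable cyclotomic complex.
From mathcomp Require Import all_classical all_reals all_analysis.
From mathcomp Require Import ring lra zify.
Import Order.TTheory GRing.Theory Num.Theory.
Import numFieldNormedType.Exports.
Import ComplexField.Normc.

(** Let q be the conjugate exponent of p. It suffices to find, for every power
K, operators of rank at most s whose p-summing norm exceeds by any prescribed
factor what can be seen with m <= A s^K vectors. They are tensor powers: for the
cube T with N = 2^l points put M(w,y) = sum_k c_k r_k(w) r_k(y), where r_0 = 1,
r_1, ..., r_l are the Rademacher functions and the c_k >= 0 have sum 1, and let u
be the operator from l_q(T^t) to l_oo(T^t) whose kernel is the t-th tensor power of
M. Its rank is at most (l+1)^t, and since M is 1 on the diagonal the unit vectors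
give pi_p(u) >= N^(t/p). For l large N exceeds every fixed power of l+1, so
polynomially many vectors are far fewer than the N^t unit vectors.

The upper bound for few vectors rests on kernels that factor through l_p in the
Pietsch way ([factorable]): such a kernel defines an operator of p-summing norm at
most N^(1/p), and the class is closed under convex combinations and tensor
products ([factorable_tensor]). The condition p <> 2 enters through
[interior_kernel]: the c_k can be chosen so that (1 - z) M + z Id is factorable
for all z in a complex disc around 0. Indeed, convolving a function F with its
dual function conj(F) |F|^(p-2) gives a factorable kernel, whose Walsh coefficient
at a character is the product of the coefficients of the two functions. For p = 2
this product is always nonnegative; for p <> 2 it can be nonreal for one
character ([direction_imaginary]) and negative at the product of two characters
([free_addb]). Hence every complex perturbation supported on a product of
characters is absorbed by the factors, and by induction all Walsh functions, hence
Id, are reached from the Rademacher functions.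

Given vectors x_i with weak l_p norm at most W, write the sum of the |u x_i|^p as
a linear functional L evaluated at the kernel of u; L is bounded on factorable
kernels. The function f(z) = L(((1 - z) M + z Id)^(tensor t)) is a polynomial,
bounded near the segment [0, 1/2]. Expanding the tensor product, a term with Id in
a set S of coordinates is small as soon as N^(|S|/p) is large compared with the
number of vectors, because each single vector sees only a fraction N^(-|S|/p) of the
bound; so f is exponentially small in t near z = 1/2, where most terms have many
factors Id ([tested_small]). A chain of discs carries the smallness from 1/2 to 0
([propagation]), and f(0) is the sum to be bounded ([few_vectors_bound]). *)

Set Implicit Arguments.
Unset Strict Implicit.
Unset Printing Implicit Defensive.

Local Open Scope classical_set_scope.
Local Open Scope ring_scope.

(** * Scalars and finite-dimensional lattice norms *)

Section Scalars.
Variables (R : realType) (F : scalars).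
Local Notation K := (scalar_field R F).

Definition real_scalar (r : R) : K :=
  match F return scalar_field R F with
  | RealScalars => r
  | ComplexScalars => (r%:C)%C
  end.

Definition modulus (a : K) : R := real_value `|a|.

Lemma norm_modulus (a : K) : `|a| = real_scalar (modulus a).
Proof.
by rewrite /modulus /real_scalar; case: F a => //= a; rewrite normc_def.
Qed.

Lemma real_value_scalar (r : R) : real_value (real_scalar r) = r.
Proof. by rewrite /real_scalar; case: F. Qed.

Lemma real_scalar_le (r s : R) : (real_scalar r <= real_scalar s) = (r <= s).
Proof. by rewrite /real_scalar; case: F => //=; rewrite lecR. Qed.

Lemma real_scalar_lt (r s : R) : (real_scalar r < real_scalar s) = (r < s).
Proof. by rewrite /real_scalar; case: F => //=; rewrite ltcR. Qed.

Lemma real_scalarD (r s : R) :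
  real_scalar (r + s) = real_scalar r + real_scalar s.
Proof. by rewrite /real_scalar; case: F => //=; rewrite rmorphD. Qed.

Lemma real_scalarM (r s : R) :
  real_scalar (r * s) = real_scalar r * real_scalar s.
Proof. by rewrite /real_scalar; case: F => //=; rewrite rmorphM. Qed.

Lemma real_scalar0 : real_scalar 0 = 0.
Proof. by rewrite /real_scalar; case: F. Qed.

Lemma real_scalar_inj : injective real_scalar.
Proof. by move=> r s /(congr1 (@real_value R F)); rewrite !real_value_scalar. Qed.

Lemma ge0_real_scalar (e : K) : 0 <= e -> e = real_scalar (real_value e).
Proof.
rewrite /real_scalar; case: F e => //= -[a b].
by rewrite lecE /= => /andP[/eqP -> _].
Qed.

Lemma modulus_ge0 a : 0 <= modulus a.
Proof. by rewrite -real_scalar_le real_scalar0 -norm_modulus. Qed.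

Lemma modulusM a b : modulus (a * b) = modulus a * modulus b.
Proof. by apply: real_scalar_inj; rewrite real_scalarM -!norm_modulus normrM. Qed.

Lemma modulusD a b : modulus (a + b) <= modulus a + modulus b.
Proof. by rewrite -real_scalar_le real_scalarD -!norm_modulus ler_normD. Qed.

Lemma modulus_eq0 a : modulus a = 0 -> a = 0.
Proof.
by move=> a0; apply: normr0_eq0; rewrite norm_modulus a0 real_scalar0.
Qed.

Lemma modulus_real_scalar (r : R) : modulus (real_scalar r) = `|r|.
Proof.
rewrite /modulus /real_scalar; case: F => //=.
by rewrite expr0n addr0 sqrtr_sqr.
Qed.

(** Real coordinates, with which completeness over either field reduces to
completeness of the real line. *)
Definition real_coord (a : K) : R :=
  match F return scalar_field R F -> R with
  | RealScalars => fun a => a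
  | ComplexScalars => fun a => complex.Re a
  end a.

Definition imag_coord (a : K) : R :=
  match F return scalar_field R F -> R with
  | RealScalars => fun=> 0
  | ComplexScalars => fun a => complex.Im a
  end a.

Definition of_coords (x y : R) : K :=
  match F return scalar_field R F with
  | RealScalars => x
  | ComplexScalars => (x +i* y)%C
  end.

Lemma real_coord_lip a b : `|real_coord a - real_coord b| <= modulus (a - b).
Proof.
rewrite /real_coord /modulus; case: F a b => //= -[a a'] [b b'] /=.
by rewrite -sqrtr_sqr ler_wsqrtr// lerDl sqr_ge0.
Qed.

Lemma imag_coord_lip a b : `|imag_coord a - imag_coord b| <= modulus (a - b).
Proof.
rewrite /imag_coord /modulus; case: F a b => //= [a b|[a a'] [b b'] /=].
  by rewrite subrr normr0.
by rewrite -sqrtr_sqr ler_wsqrtr// lerDr sqr_ge0.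
Qed.

Lemma modulus_of_coords x y a :
  modulus (of_coords x y - a) <= `|x - real_coord a| + `|y - imag_coord a|.
Proof.
rewrite /of_coords /real_coord /imag_coord /modulus.
case: F a => //= [a|[a b]]; first by rewrite lerDl.
rewrite -[leRHS]ger0_norm ?addr_ge0// -sqrtr_sqr ler_wsqrtr//.
rewrite [leRHS]sqrrD !real_normK ?num_real//.
by rewrite -addrA addrCA lerDr mulrn_wge0// mulr_ge0.
Qed.

End Scalars.

(** One construction serves for the l_q and the sup norm. The last two fields bound
the norm by the coordinates from both sides, which gives completeness. *)
Record lattice_norm (R : realType) (T : finType) := LatticeNorm {
  lnorm :> (T -> R) -> R;
  lnorm_mono : forall a b, (forall t, 0 <= a t <= b t) -> lnorm a <= lnorm b;
  lnormD : forall a b, (forall t, 0 <= a t) -> (forall t, 0 <= b t) ->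
    lnorm (fun t => a t + b t) <= lnorm a + lnorm b;
  lnormZ : forall c a, 0 <= c -> (forall t, 0 <= a t) ->
    lnorm (fun t => c * a t) = c * lnorm a;
  lnorm_coord : forall a t, (forall t, 0 <= a t) -> a t <= lnorm a;
  lnorm_sum : forall a, (forall t, 0 <= a t) -> lnorm a <= \sum_t a t }.

Definition lattice_space (R : realType) (F : scalars) (T : finType)
  (N : lattice_norm R T) := {ffun T -> (scalar_field R F)^o}.

Section LatticeSpace.
Variables (R : realType) (F : scalars) (T : finType) (N : lattice_norm R T).
Local Notation K := (scalar_field R F).
Local Notation X := (@lattice_space R F T N).

HB.instance Definition _ := GRing.Lmodule.on X.

Definition lattice_rnorm (x : X) : R := N (fun t => modulus (x t)).

Lemma lattice_rnormD x y :
  lattice_rnorm (x + y) <= lattice_rnorm x + lattice_rnorm y.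
Proof.
apply: le_trans (lnormD N _ _); rewrite /=; last 2 first.
- by move=> t; exact: modulus_ge0.
- by move=> t; exact: modulus_ge0.
by apply: lnorm_mono => t; rewrite modulus_ge0 ffunE modulusD.
Qed.

Lemma lattice_rnormZ (l : K) x :
  lattice_rnorm (l *: x) = modulus l * lattice_rnorm x.
Proof.
rewrite /lattice_rnorm -lnormZ ?modulus_ge0//; last first.
  by move=> t; exact: modulus_ge0.
by congr (lnorm _ _); apply/funext => t; rewrite ffunE modulusM.
Qed.

Lemma lattice_rnorm_eq0 x : lattice_rnorm x = 0 -> x = 0.
Proof.
move=> x0; apply/ffunP => t; rewrite ffunE; apply: modulus_eq0.
apply/eqP; rewrite eq_le modulus_ge0 andbT -x0.
by apply: (lnorm_coord N (a := fun t => modulus (x t))) => ?; exact: modulus_ge0.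
Qed.

Let norm (x : X) : K := real_scalar F (lattice_rnorm x).

Let normD x y : norm (x + y) <= norm x + norm y.
Proof. by rewrite /norm -real_scalarD real_scalar_le lattice_rnormD. Qed.

Let normZ (l : K) x : norm (l *: x) = `|l| * norm x.
Proof. by rewrite /norm lattice_rnormZ real_scalarM -norm_modulus. Qed.

Let norm_eq0 x : norm x = 0 -> x = 0.
Proof.
rewrite -(real_scalar0 R F) => /real_scalar_inj; exact: lattice_rnorm_eq0.
Qed.

HB.instance Definition _ := Lmodule_isNormed.Build K X normD normZ norm_eq0.

Lemma rnorm_lattice (x : X) : rnorm x = lattice_rnorm x.
Proof. exact: real_value_scalar. Qed.

Lemma norm_lattice (x : X) : `|x| = real_scalar F (lattice_rnorm x).
Proof. by []. Qed.

Lemma coord_ball (x : X) (e : R) (t : T) (y : X) :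
  ball x (real_scalar F e) y -> modulus (x t - y t) < e.
Proof.
rewrite -ball_normE /ball_ /= norm_lattice real_scalar_lt; apply: le_lt_trans.
apply: le_trans (lnorm_coord N (a := fun t => modulus ((x - y) t)) t _).
  by rewrite !ffunE.
by move=> ?; exact: modulus_ge0.
Qed.

(** A Cauchy filter converges coordinatewise, and the norm is dominated by the sum
of the moduli of the finitely many coordinates. *)
Lemma lattice_complete (G : set_system X) :
  ProperFilter G -> cauchy G -> cvg G.
Proof.
move=> PG /cauchyP cG; apply/cvg_ex => /=.
have lim_coord (g : K -> R) : (forall a b, `|g a - g b| <= modulus (a - b)) ->
    exists l : T -> R, forall t (e : R), 0 < e -> G [set x : X | `|l t - g (x t)| < e].
  move=> glip; suff /choice[l lP] : forall t, exists l : R,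
      forall e : R, 0 < e -> G [set x : X | `|l - g (x t)| < e] by exists l.
  move=> t; have : cvg ((fun x : X => g (x t) : R^o) @ G).
    apply: R_complete; apply/cauchy_exP => e e0.
    have [|x xG] := cG (real_scalar F e).
      by rewrite -(real_scalar0 R F) real_scalar_lt.
    exists (g (x t)); change (G [set y : X | ball (g (x t)) e (g (y t))]).
    apply: filterS xG => y /(@coord_ball _ _ t) xy /=.
    by rewrite -ball_normE /ball_ /=; apply: le_lt_trans xy; exact: glip.
  move=> /cvg_ex[l gl]; exists l => e e0.
  by move/cvgrPdist_lt : gl => /(_ e e0).
have [l lP] := lim_coord _ (@real_coord_lip R F).
have [m mP] := lim_coord _ (@imag_coord_lip R F).
exists ([ffun t => of_coords F (l t) (m t)] : X).
apply/cvg_ballP => e e0.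
rewrite (ge0_real_scalar (ltW e0)); set d := real_value e.
have d0 : 0 < d by rewrite -(real_scalar_lt F) real_scalar0 -ge0_real_scalar ?ltW.
pose c := d / (#|T|.+1%:R *+ 2).
have c0 : 0 < c by rewrite divr_gt0// pmulrn_rgt0// ltr0n.
have : G [set x : X | forall t, `|l t - real_coord (x t)| < c /\
                                `|m t - imag_coord (x t)| < c].
  apply: filter_forall => t.
  exact: (filterI (lP t c c0) (mP t c c0)).
apply: filterS => x xl.
rewrite -ball_normE /ball_ /= norm_lattice real_scalar_lt.
set z := (X in lattice_rnorm X).
apply: (@le_lt_trans _ _ (\sum_t modulus (z t))).
  by apply: (lnorm_sum N) => t; exact: modulus_ge0.
apply: (@le_lt_trans _ _ (\sum_(t : T) (c + c))).
  apply: ler_sum => t _; rewrite !ffunE; apply: le_trans (modulus_of_coords _ _ _) _.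
  by have [/ltW ? /ltW ?] := xl t; exact: lerD.
have -> : d = c *+ 2 *+ #|T|.+1.
  rewrite -mulrnA -mulr_natr /c -mulr_natr -natrM [(#|T|.+1 * 2)%N]mulnC.
  by rewrite divfK// pnatr_eq0.
rewrite sumr_const -mulr2n ltr_pMn2l ?pmulrn_rgt0//.
Qed.

HB.instance Definition _ := Uniform_isComplete.Build X lattice_complete.

End LatticeSpace.

(** * Finite l_q norms *)

Section PowerSums.
Variables (R : realType) (T : finType).
Implicit Types (a b : T -> R) (p q : R).

Lemma powR_invK (x p : R) : 0 <= x -> p != 0 -> (x `^ p^-1) `^ p = x.
Proof. by move=> x0 p0; rewrite -powRrM mulVf// powRr1. Qed.

Lemma powRK_inv (x p : R) : 0 <= x -> p != 0 -> (x `^ p) `^ p^-1 = x.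
Proof. by move=> x0 p0; rewrite -powRrM mulfV// powRr1. Qed.

Lemma one_powR (x : R) : 1 `^ x = 1.
Proof. by rewrite powR1. Qed.

Lemma exprn_powR (x s : R) n : 0 <= x -> (x `^ s) ^+ n = (x ^+ n) `^ s.
Proof. by move=> x0; rewrite -(powR_mulrn _ (powR_ge0 x s)) powRAC powR_mulrn. Qed.

Lemma ler_of_powR (x y r : R) : 0 < r -> 0 <= x -> 0 <= y -> x `^ r <= y `^ r -> x <= y.
Proof.
move=> r0 x0 y0; have [//|yx] := leP x y.
have := gt0_ltr_powR r0 y0 x0 yx; by rewrite ltNge => /negP.
Qed.

Lemma sum_powR_ge0 a p : 0 <= \sum_t a t `^ p.
Proof. by apply: sumr_ge0 => t _; exact: powR_ge0. Qed.

Lemma sum_powR_eq0 a p : 0 < p -> \sum_t a t `^ p <= 0 -> forall t, a t = 0.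
Proof.
move=> p0 s0 t; apply/eqP.
have /psumr_eq0P : \sum_t a t `^ p = 0.
  by apply/eqP; rewrite eq_le s0 sum_powR_ge0.
by move=> /(_ (fun t _ => powR_ge0 _ _) t isT) /powR_eq0_eq0 ->.
Qed.

(** Young's inequality after normalising [a] by [A] and [b] by [B]. *)
Lemma hoelder_sum p q a b (A B : R) : 0 < p -> 0 < q -> p^-1 + q^-1 = 1 ->
  (forall t, 0 <= a t) -> (forall t, 0 <= b t) -> 0 <= A -> 0 <= B ->
  \sum_t a t `^ p <= A `^ p -> \sum_t b t `^ q <= B `^ q ->
  \sum_t a t * b t <= A * B.
Proof.
move=> p0 q0 pq a0 b0; rewrite le_eqVlt => /predU1P[<- _|A0].
  rewrite powR0 ?gt_eqF// => /(sum_powR_eq0 p0) az _.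
  by rewrite mul0r big1// => t _; rewrite az mul0r.
rewrite le_eqVlt => /predU1P[<- _|B0].
  rewrite powR0 ?gt_eqF// => /(sum_powR_eq0 q0) bz.
  by rewrite mulr0 big1// => t _; rewrite bz mulr0.
move=> aA bB; have AB0 : 0 < A * B by rewrite mulr_gt0.
rewrite -[leRHS]mul1r -ler_pdivrMr// mulr_suml.
have norm1 c C r : 0 < r -> 0 < C -> (forall t, 0 <= c t) ->
    \sum_t c t `^ r <= C `^ r -> \sum_t (c t / C) `^ r / r <= r^-1.
  move=> r0 C0 c0 cC; rewrite -mulr_suml ler_piMl ?invr_ge0 ?(ltW r0)//.
  under eq_bigr => t _ do rewrite powRM ?invr_ge0 1?(ltW C0)//.
  have -> : C^-1 `^ r = (C `^ r)^-1.
    by rewrite -[C^-1]powR_inv1 ?(ltW C0)// powRAC powR_inv1 ?powR_ge0.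
  by rewrite -mulr_suml ler_pdivrMr ?powR_gt0// mul1r.
apply: le_trans (_ : \sum_t ((a t / A) `^ p / p + (b t / B) `^ q / q) <= _).
  apply: ler_sum => t _; rewrite invfM mulrACA.
  by apply: conjugate_powR => //; rewrite divr_ge0// ltW.
by rewrite big_split /= -pq lerD// norm1.
Qed.

Definition lq_norm q a : R := (\sum_t a t `^ q) `^ q^-1.

Lemma lq_norm_ge0 q a : 0 <= lq_norm q a. Proof. exact: powR_ge0. Qed.

Lemma lq_normE q a : q != 0 -> lq_norm q a `^ q = \sum_t a t `^ q.
Proof. by move=> q0; rewrite powR_invK// sum_powR_ge0. Qed.

Lemma lq_norm_le q a B : 0 < q -> 0 <= B ->
  (lq_norm q a <= B) = (\sum_t a t `^ q <= B `^ q).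
Proof.
move=> q0 B0; rewrite -lq_normE ?gt_eqF//; apply/idP/idP => h.
  by rewrite ge0_ler_powR// ?nnegrE ?lq_norm_ge0// ltW.
by rewrite leNgt; apply/negP => /(gt0_ltr_powR q0); rewrite ltNge h !nnegrE lq_norm_ge0 => /(_ B0 isT).
Qed.

Lemma lq_norm_mono q a b : 0 < q ->
  (forall t, 0 <= a t <= b t) -> lq_norm q a <= lq_norm q b.
Proof.
move=> q0 ab; rewrite ge0_ler_powR ?invr_ge0 ?nnegrE ?sum_powR_ge0//; first exact: ltW.
apply: ler_sum => t _; have /andP[at0 atb] := ab t.
by rewrite ge0_ler_powR ?nnegrE//; [exact: ltW|exact: le_trans atb].
Qed.

Lemma lq_normZ q (c : R) a : 0 < q -> 0 <= c -> (forall t, 0 <= a t) ->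
  lq_norm q (fun t => c * a t) = c * lq_norm q a.
Proof.
move=> q0 c0 a0; rewrite /lq_norm; under eq_bigr do rewrite powRM//.
by rewrite -mulr_sumr powRM ?powR_ge0 ?sum_powR_ge0// powRK_inv// gt_eqF.
Qed.

Lemma lq_norm_coord q a t : 0 < q -> (forall t, 0 <= a t) -> a t <= lq_norm q a.
Proof.
move=> q0 a0; rewrite -[leLHS](@powRK_inv _ q) ?gt_eqF//.
rewrite ge0_ler_powR ?invr_ge0 ?nnegrE ?powR_ge0 ?sum_powR_ge0//; first exact: ltW.
by rewrite (bigD1 t)//= lerDl; apply: sumr_ge0 => ? _; exact: powR_ge0.
Qed.

(** Minkowski's inequality: split the q-th power of the sum as
(a + b) (a + b)^(q-1) and apply Hoelder's inequality to each half. *)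
Lemma lq_normD q a b : 1 < q -> (forall t, 0 <= a t) -> (forall t, 0 <= b t) ->
  lq_norm q (fun t => a t + b t) <= lq_norm q a + lq_norm q b.
Proof.
move=> q1 a0 b0; have q0 : 0 < q by rewrite (lt_trans _ q1).
set S := lq_norm q (fun t => a t + b t).
have := lq_norm_ge0 q (fun t => a t + b t); rewrite -/S le_eqVlt => /predU1P[<-|S0].
  by rewrite addr_ge0 ?lq_norm_ge0.
have q10 : 0 < q - 1 by rewrite subr_gt0.
pose p := q / (q - 1).
have p0 : 0 < p by rewrite divr_gt0.
have pq : q^-1 + p^-1 = 1.
  by rewrite /p invf_div mulrBl divff ?gt_eqF// mul1r addrC subrK.
have E : (q - 1) * p = q by rewrite /p mulrCA divff ?mulr1// gt_eqF.
have half c : (forall t, 0 <= c t) ->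
    \sum_t c t * (a t + b t) `^ (q - 1) <= lq_norm q c * S `^ (q - 1).
  move=> c0; apply: (hoelder_sum q0 p0 pq c0 _ (lq_norm_ge0 q c) (powR_ge0 S (q - 1))).
  - by move=> t; exact: powR_ge0.
  - by rewrite lq_normE// gt_eqF.
  - under eq_bigr do rewrite -powRrM E.
    by rewrite -powRrM E lq_normE// gt_eqF.
have : S `^ q <= (lq_norm q a + lq_norm q b) * S `^ (q - 1).
  rewrite lq_normE ?gt_eqF// mulrDl.
  apply: le_trans (lerD (half _ a0) (half _ b0)).
  rewrite -big_split /=; apply: ler_sum => t _.
  by rewrite -mulrDl mulr_powRB1// addr_ge0.
rewrite -[leLHS](mulr_powRB1 (ltW S0) q0) ler_pM2r// powR_gt0//.
Qed.

Lemma lq_norm_sum q a : 1 < q -> (forall t, 0 <= a t) -> lq_norm q a <= \sum_t a t.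
Proof.
move=> q1 a0; have q0 : 0 < q by rewrite (lt_trans _ q1).
have S0 : 0 <= \sum_t a t by apply: sumr_ge0.
rewrite lq_norm_le// -(mulr_powRB1 S0 q0) mulr_suml.
apply: ler_sum => t _; rewrite -(mulr_powRB1 (a0 t) q0) ler_wpM2l//.
rewrite ge0_ler_powR ?nnegrE//; first by rewrite subr_ge0 ltW.
by rewrite (bigD1 t)//= lerDl sumr_ge0.
Qed.

Definition lq_lattice_norm q (q1 : 1 < q) : lattice_norm R T :=
  let q0 := lt_trans ltr01 q1 in
  LatticeNorm (fun a b => @lq_norm_mono q a b q0) (fun a b => @lq_normD q a b q1)
    (fun c a => @lq_normZ q c a q0) (fun a t => @lq_norm_coord q a t q0)
    (fun a => @lq_norm_sum q a q1).

Definition sup_norm a : R := \big[Num.max/0]_t a t.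

Lemma sup_norm_coord a t : a t <= sup_norm a.
Proof. exact: le_bigmax. Qed.

Lemma sup_norm_le a (c : R) : 0 <= c -> (forall t, a t <= c) -> sup_norm a <= c.
Proof. by move=> c0 ac; apply: bigmax_le. Qed.

Lemma sup_norm_ge0 a : 0 <= sup_norm a.
Proof. exact: bigmax_ge_id. Qed.

Lemma sup_norm_mono a b : (forall t, 0 <= a t <= b t) -> sup_norm a <= sup_norm b.
Proof.
move=> ab; apply: sup_norm_le (sup_norm_ge0 _) _ => t.
by have /andP[_ /le_trans->] := ab t => //; exact: sup_norm_coord.
Qed.

Lemma sup_normD a b : (forall t, 0 <= a t) -> (forall t, 0 <= b t) ->
  sup_norm (fun t => a t + b t) <= sup_norm a + sup_norm b.
Proof.
move=> _ _; apply: sup_norm_le; first by rewrite addr_ge0 ?sup_norm_ge0.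
by move=> t; rewrite lerD// sup_norm_coord.
Qed.

Lemma sup_normZ (c : R) a : 0 <= c -> (forall t, 0 <= a t) ->
  sup_norm (fun t => c * a t) = c * sup_norm a.
Proof.
move=> c0 a0; apply/eqP; rewrite eq_le; apply/andP; split.
  apply: sup_norm_le => [|t]; first by rewrite mulr_ge0// sup_norm_ge0.
  by rewrite ler_wpM2l// sup_norm_coord.
have [->|cN0] := eqVneq c 0; first by rewrite mul0r sup_norm_ge0.
have {}c0 : 0 < c by rewrite lt_def cN0.
rewrite -ler_pdivlMl//; apply: sup_norm_le => [|t].
  by rewrite mulr_ge0 ?invr_ge0 ?sup_norm_ge0// ltW.
by rewrite ler_pdivlMl//; exact: (sup_norm_coord (fun t => c * a t)).
Qed.

Lemma sup_norm_sum a : (forall t, 0 <= a t) -> sup_norm a <= \sum_t a t.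
Proof.
move=> a0; apply: sup_norm_le => [|t]; first exact: sumr_ge0.
by rewrite (bigD1 t)//= lerDl sumr_ge0.
Qed.

Definition sup_lattice_norm : lattice_norm R T :=
  LatticeNorm sup_norm_mono sup_normD sup_normZ
    (fun a t _ => sup_norm_coord a t) sup_norm_sum.

End PowerSums.

(** * Kernel operators from l_q to l_oo *)

Section FiniteRank.
Variables (K : fieldType) (Y : lmodType K).

(** A subspace of the span of s vectors is itself the span of s vectors. If the last
vector is needed for some element z of the subspace, then z can replace it, as
subtracting a multiple of z removes the last coordinate. *)
Lemma subspace_span s (v : 'I_s -> Y) (S : set Y) :
  S 0 -> (forall (a : K) x y, S x -> S y -> S (a *: x + y)) ->
  (forall x, S x -> exists a : 'I_s -> K, x = \sum_(i < s) a i *: v i) ->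
  exists w : 'I_s -> Y, S = [set \sum_(i < s) a i *: w i | a in [set: 'I_s -> K]].
Proof.
elim: s v S => [|s IH] v S S0 SL Sv.
  exists v; apply/seteqP; split=> x.
    by move=> /Sv[a xa]; exists a.
  by move=> [a _ <-]; rewrite big_ord0.
pose v' i := v (widen_ord (leqnSn s) i).
pose S' := [set x | S x /\ exists a : 'I_s -> K, x = \sum_(i < s) a i *: v' i].
have [|a x y [Sx [b xb]] [Sy [c yc]]|x [] //|w S'w] := IH v' S'.
- by split=> //; exists (fun=> 0); rewrite big1// => i _; rewrite scale0r.
- split; first exact: SL.
  exists (fun i => a * b i + c i); rewrite xb yc scaler_sumr -big_split/=.
  by apply: eq_bigr => i _; rewrite scalerDl scalerA.
have S'S x : S' x -> S x by case.
have [z zP] : exists z : Y, S z /\ forall x, S x -> exists b, S' (x - b *: z).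
  have [SS'|/existsNP[z /not_implyP[Sz S'z]]] := pselect (forall x, S x -> S' x).
    exists 0; split=> // x Sx; exists 0.
    by rewrite scaler0 subr0; exact: SS'.
  exists z; split=> // x Sx.
  have [a za] := Sv _ Sz; have [b xb] := Sv _ Sx.
  have aN0 : a ord_max != 0.
    apply/eqP => a0; apply: S'z; split=> //.
    exists (fun i => a (widen_ord (leqnSn s) i)).
    by rewrite za big_ord_recr /= a0 scale0r addr0.
  exists (b ord_max / a ord_max); split.
    by rewrite addrC -scaleNr; exact: SL.
  exists (fun i => b (widen_ord (leqnSn s) i) -
                   b ord_max / a ord_max * a (widen_ord (leqnSn s) i)).
  rewrite xb za !big_ord_recr /= scalerDr scalerA divfK// opprD addrACA subrr addr0.
  rewrite scaler_sumr -sumrB; apply: eq_bigr => i _.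
  by rewrite scalerBl scalerA.
case: zP => Sz zP.
exists (fun i => if unlift ord_max i is Some j then w j else z).
have sumE (a : 'I_s.+1 -> K) : \sum_(i < s.+1)
    a i *: (if unlift ord_max i is Some j then w j else z) =
    \sum_(i < s) a (lift ord_max i) *: w i + a ord_max *: z.
  rewrite big_ord_recr /= unlift_none; congr (_ + _); apply: eq_bigr => i _.
  have -> : widen_ord (leqnSn s) i = lift ord_max i.
    by apply: val_inj; rewrite /= /bump leqNgt ltn_ord.
  by rewrite liftK.
apply/seteqP; split=> x.
  move=> /zP[b]; rewrite S'w => -[a _ xa].
  exists (fun i => if unlift ord_max i is Some j then a j else b) => //.
  rewrite sumE unlift_none; under eq_bigr do rewrite liftK.
  by rewrite xa subrK.
move=> [a _ <-]; rewrite sumE addrC; apply: SL => //.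
by apply: S'S; rewrite S'w; exists (fun i => a (lift ord_max i)).
Qed.

End FiniteRank.

Section Duality.
Variables (R : realType) (F : scalars).
Local Notation K := (scalar_field R F).

Lemma rank_at_most_sub (X Y : normedModType K) (u : {linear X -> Y}) r s
    (v : 'I_r -> Y) : (r <= s)%N ->
  (forall x, exists a : 'I_r -> K, u x = \sum_(i < r) a i *: v i) ->
  rank_at_most s u.
Proof.
move=> rs uv; apply: (@subspace_span K Y s
    (fun i => if insub (val i) is Some j then v j else 0)).
- by exists 0; rewrite ?linear0.
- by move=> a _ _ [x _ <-] [y _ <-]; exists (a *: x + y); rewrite ?linearP.
move=> _ [x _ <-]; have [a ->] := uv x.
exists (fun i => if insub (val i) is Some j then a j else 0).
pose G (k : nat) := if insub k is Some j then a j *: v j else 0.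
transitivity (\sum_(i < r) G i); first by apply: eq_bigr => i _; rewrite /G valK.
rewrite (big_ord_widen _ G rs) big_mkcond/=; apply: eq_bigr => i _; rewrite /G.
by case: insubP => [j -> _ //|/negPf->]; rewrite scale0r.
Qed.

Lemma rnorm_regular (a : K^o) : rnorm a = modulus a.
Proof. by []. Qed.

Lemma modulus_sum (I : finType) (f : I -> K) :
  modulus (\sum_i f i) <= \sum_i modulus (f i).
Proof.
elim/big_rec2: _ => [|i y x _ yx].
  by rewrite -(real_scalar0 R F) modulus_real_scalar normr0.
by apply: le_trans (modulusD _ _) _; rewrite lerD2l.
Qed.

Lemma norm_rnorm (X : normedModType K) (x : X) : `|x| = real_scalar F (rnorm x).
Proof. exact: ge0_real_scalar. Qed.

Lemma rnormZ (X : normedModType K) (a : K) (x : X) :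
  rnorm (a *: x) = modulus a * rnorm x.
Proof.
apply: (@real_scalar_inj R F).
by rewrite real_scalarM -norm_modulus -!norm_rnorm normrZ.
Qed.

Lemma rnorm_ge0 (X : normedModType K) (x : X) : 0 <= rnorm x.
Proof. by rewrite -(real_scalar_le F) real_scalar0 -norm_rnorm. Qed.

Lemma rnorm_eq0 (X : normedModType K) (x : X) : rnorm x = 0 -> x = 0.
Proof. by move=> x0; apply: normr0_eq0; rewrite norm_rnorm x0 real_scalar0. Qed.

Lemma rnorm0 (X : normedModType K) : rnorm (0 : X) = 0.
Proof. by rewrite /rnorm normr0 -[X in real_value X](real_scalar0 R F) real_value_scalar. Qed.

Lemma dual_unit_ball_le (X : normedModType K) (f : {linear X -> K^o}) x :
  dual_unit_ball f -> rnorm (f x) <= rnorm x.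
Proof.
move=> [_ f1].
have [/rnorm_eq0 ->|xN0] := eqVneq (rnorm x) 0; first by rewrite linear0 !rnorm0.
have x0 : 0 < rnorm x by rewrite lt_def xN0 rnorm_ge0.
have inv0 : 0 <= (rnorm x)^-1 by rewrite invr_ge0 ltW.
pose y := real_scalar F (rnorm x)^-1 *: x.
have : ((rnorm (f y))%:E <= 1)%E.
  apply: le_trans f1; apply: ereal_sup_ubound; exists y => //=.
  by rewrite /y rnormZ modulus_real_scalar ger0_norm// mulVf.
by rewrite /y linearZ lee_fin rnormZ modulus_real_scalar ger0_norm// ler_pdivrMl// mulr1.
Qed.

Variables (T : finType) (p q : R).
Hypotheses (p1 : 1 < p) (q1 : 1 < q) (pq : p^-1 + q^-1 = 1).

Let p0 : 0 < p. Proof. exact: lt_trans p1. Qed.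
Let q0 : 0 < q. Proof. exact: lt_trans q1. Qed.

Local Notation X := (lattice_space F (lq_lattice_norm T q1)).
Local Notation Y := (lattice_space F (sup_lattice_norm R T)).

Definition pairing (g : T -> K) (x : X) : K^o := \sum_t g t * (x : {ffun T -> K^o}) t.

Lemma pairing_linear g : linear (pairing g).
Proof.
move=> a x y; rewrite /pairing scaler_sumr -big_split/=; apply: eq_bigr => t _.
by rewrite !ffunE mulrDr /GRing.scale/= mulrCA.
Qed.
HB.instance Definition _ g := GRing.isLinear.Build K X K^o *:%R (pairing g) (pairing_linear g).

Lemma rnorm_pairing g x : rnorm (pairing g x) <=
  lq_norm p (fun t => modulus (g t)) * rnorm x.
Proof.
rewrite rnorm_regular rnorm_lattice; apply: le_trans (modulus_sum _) _.
under eq_bigr do rewrite modulusM.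
apply: (hoelder_sum p0 q0 pq) => //; do ?by [move=> t; exact: modulus_ge0|exact: lq_norm_ge0].
  by rewrite lq_normE ?gt_eqF.
by rewrite lq_normE ?gt_eqF.
Qed.

(** The unit ball of l_p acts on l_q as functionals of norm at most one. *)
Lemma pairing_dual_unit_ball g :
  \sum_t modulus (g t) `^ p <= 1 -> dual_unit_ball (pairing g).
Proof.
move=> g1; have {}g1 : lq_norm p (fun t => modulus (g t)) <= 1.
  by rewrite lq_norm_le// powR1.
have gle x : rnorm (pairing g x) <= rnorm x.
  apply: le_trans (rnorm_pairing g x) _.
  by rewrite ler_piMl// rnorm_ge0.
split; first by exists 1 => x; rewrite mul1r; exact: gle.
apply: ge_ereal_sup => _ [x /= x1 <-]; rewrite lee_fin.
exact: le_trans (gle x) x1.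
Qed.

Lemma weak_lp_norm_ge0 m (x : 'I_m -> X) : (0 <= weak_lp_norm p x)%E.
Proof.
apply: le_ereal_sup_tmp; exists (lp_norm p (fun i => pairing (fun=> 0) (x i)))%:E; last first.
  by rewrite lee_fin powR_ge0.
exists (pairing (fun=> 0)) => //; apply: pairing_dual_unit_ball.
rewrite big1// => t _.
by rewrite -(real_scalar0 R F) modulus_real_scalar normr0 powR0// gt_eqF.
Qed.

(** The weak l_p bound by [W], in homogeneous form: tested against all coefficient
vectors instead of the dual unit ball. *)
Definition weakly_bounded m (W : R) (x : 'I_m -> T -> K) :=
  forall g : T -> K,
    \sum_i modulus (\sum_t g t * x i t) `^ p <= W `^ p * \sum_t modulus (g t) `^ p.

Lemma weak_lp_norm_bounded m (x : 'I_m -> X) (W : R) : 0 <= W ->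
  (weak_lp_norm p x <= W%:E)%E ->
  weakly_bounded W (fun i t => (x i : {ffun T -> K^o}) t).
Proof.
move=> W0 xW g; set G := lq_norm p (fun t => modulus (g t)).
have GE : \sum_t modulus (g t) `^ p = G `^ p by rewrite lq_normE ?gt_eqF.
have [G0|GN0] := eqVneq G 0.
  have g0 t : g t = 0.
    apply: modulus_eq0; apply: (@sum_powR_eq0 _ _ (fun t => modulus (g t)) p) => //.
    by rewrite GE G0 powR0 ?gt_eqF.
  rewrite GE G0 powR0 ?gt_eqF// mulr0 big1// => i _.
  rewrite big1 ?[modulus _](modulus_real_scalar F 0) => [|t _]; last by rewrite g0 mul0r.
  by rewrite -(real_scalar0 R F) modulus_real_scalar normr0 powR0// gt_eqF.
have G0 : 0 < G by rewrite lt_def GN0 lq_norm_ge0.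
have Gi0 : 0 <= G^-1 by rewrite invr_ge0 ltW.
pose g' t := real_scalar F G^-1 * g t.
have g'1 : dual_unit_ball (pairing g').
  apply: pairing_dual_unit_ball; rewrite le_eqVlt; apply/orP; left; apply/eqP.
  under eq_bigr do rewrite modulusM modulus_real_scalar ger0_norm// powRM ?modulus_ge0//.
  by rewrite -mulr_sumr GE -powRM ?(ltW G0)// mulVf// powR1.
have : ((lp_norm p (fun i => pairing g' (x i)))%:E <= W%:E)%E.
  by apply: le_trans xW; apply: ereal_sup_ubound; exists (pairing g').
rewrite lee_fin -[lp_norm _ _]/(lq_norm p (fun i => rnorm (pairing g' (x i)))).
rewrite lq_norm_le// => h.
have Gp0 : 0 < G `^ p by rewrite powR_gt0.
rewrite GE -(ler_pdivrMr _ _ Gp0); apply: le_trans h.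
rewrite mulr_suml; apply: ler_sum => i _.
rewrite rnorm_regular /pairing /g'.
under [in leRHS]eq_bigr do rewrite -mulrA.
rewrite -mulr_sumr modulusM modulus_real_scalar ger0_norm// powRM ?modulus_ge0//.
by rewrite -[G^-1]powR_inv1 ?(ltW G0)// powRAC powR_inv1 ?powR_ge0// mulrC.
Qed.

Lemma conjugate_exponent : (p - 1) * q = p.
Proof.
have pN0 : p != 0 by rewrite gt_eqF.
have qN0 : q != 0 by rewrite gt_eqF.
rewrite mulrBl mul1r -[p * q]mul1r -pq mulrDl mulKf// [p * q]mulrC mulKf//.
by rewrite addrAC subrr add0r.
Qed.

Definition unit_vector (t : T) : X := [ffun s => (s == t)%:R].

(** The values of a functional of norm at most one on the unit vectors have l_p norm
at most one: test it on the vector that norms these values. *)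
Lemma unit_vectors_weak (f : {linear X -> K^o}) : dual_unit_ball f ->
  \sum_t modulus (f (unit_vector t)) `^ p <= 1.
Proof.
move=> f1; set c := fun t => modulus (f (unit_vector t)).
set S := \sum_t c t `^ p.
pose s t : K := if f (unit_vector t) == 0 then 0
  else real_scalar F (c t `^ p) / f (unit_vector t).
pose x : X := [ffun t => s t].
have fx : f x = real_scalar F S.
  have -> : x = \sum_t s t *: unit_vector t.
    apply/ffunP => t; rewrite sum_ffunE ffunE (bigD1 t)//= big1 => [|u ut].
      by rewrite !ffunE eqxx addr0 /GRing.scale/= mulr1.
    by rewrite !ffunE eq_sym (negPf ut) /GRing.scale/= mulr0.
  rewrite linear_sum /S.
  rewrite (big_morph (real_scalar F) (@real_scalarD R F) (real_scalar0 R F)).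
  apply: eq_bigr => t _; rewrite linearZ /= /s /GRing.scale/=.
  case: eqP => [f0|/eqP fN0]; last by rewrite divfK.
  rewrite mul0r /c f0 -(real_scalar0 R F) modulus_real_scalar normr0 powR0 ?gt_eqF//.
have S0 : 0 <= S by exact: sum_powR_ge0.
have xS : rnorm x <= S `^ q^-1.
  rewrite rnorm_lattice /lattice_rnorm /= lq_norm_le ?powR_ge0// powR_invK ?gt_eqF//.
  apply: ler_sum => t _; rewrite ffunE /s /c; case: eqP => [f0|/eqP fN0].
    by rewrite -(real_scalar0 R F) modulus_real_scalar normr0 powR0 ?powR_ge0 ?gt_eqF.
  have cN0 : modulus (f (unit_vector t)) != 0 by apply: contraNneq fN0 => /modulus_eq0 ->.
  have -> : modulus (real_scalar F (modulus (f (unit_vector t)) `^ p) / f (unit_vector t)) =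
            modulus (f (unit_vector t)) `^ (p - 1).
    apply: (mulIf cN0); rewrite -modulusM divfK// modulus_real_scalar ger0_norm ?powR_ge0//.
    by rewrite mulrC mulr_powRB1// modulus_ge0.
  by rewrite -powRrM conjugate_exponent.
have := dual_unit_ball_le x f1.
rewrite fx rnorm_regular modulus_real_scalar ger0_norm// => /le_trans/(_ xS) SS.
rewrite leNgt; apply/negP => S1.
have {SS} : S * S `^ (q - 1) <= S * 1.
  rewrite mulr1 mulr_powRB1// -[leRHS](@powR_invK _ _ q) ?gt_eqF//.
  by rewrite ge0_ler_powR ?nnegrE ?powR_ge0// ltW.
rewrite ler_pM2l ?(lt_trans _ S1)//; apply/negP; rewrite -ltNge.
rewrite -[ltLHS](one_powR (q - 1)).
by apply: gt0_ltr_powR; rewrite ?subr_gt0 ?nnegrE// ltW.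
Qed.

Lemma weak_lp_norm_unit_vectors :
  (weak_lp_norm p (fun i : 'I_#|T| => unit_vector (enum_val i)) <= 1)%E.
Proof.
apply: ge_ereal_sup => _ [f f1 <-]; rewrite lee_fin.
rewrite -[leLHS]/(lq_norm p (fun i => rnorm (f (unit_vector (enum_val i))))).
rewrite lq_norm_le// powR1; apply: le_trans (unit_vectors_weak f1).
rewrite [leRHS](reindex (@enum_val T T)) /=; last exact: onW_bij (@enum_val_bij T).
exact: lexx.
Qed.

Variable M : T -> T -> R.

Definition kernel_op (f : X) : Y :=
  [ffun w => \sum_y real_scalar F (M w y) * (f : {ffun T -> K^o}) y].

Lemma kernel_op_linear : linear kernel_op.
Proof.
move=> a f g; apply/ffunP => w; rewrite !ffunE scaler_sumr -big_split/=.
by apply: eq_bigr => y _; rewrite !ffunE mulrDr /GRing.scale/= mulrCA.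
Qed.
HB.instance Definition _ := GRing.isLinear.Build K X Y *:%R kernel_op kernel_op_linear.

Lemma rnorm_kernel_op (f : X) : rnorm (kernel_op f) =
  sup_norm (fun w => modulus (\sum_y real_scalar F (M w y) * (f : {ffun T -> K^o}) y)).
Proof.
rewrite rnorm_lattice /lattice_rnorm /=; congr sup_norm; apply/funext => w.
by rewrite ffunE.
Qed.

Lemma kernel_op_bounded : bounded_operator kernel_op.
Proof.
exists (\sum_w \sum_y `|M w y|) => f; rewrite rnorm_kernel_op.
apply: sup_norm_le => [|w].
  by rewrite mulr_ge0 ?rnorm_ge0 ?sumr_ge0// => w _; rewrite sumr_ge0.
apply: le_trans (modulus_sum _) _.
apply: (@le_trans _ _ ((\sum_y `|M w y|) * rnorm f)).
  rewrite mulr_suml; apply: ler_sum => y _.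
  rewrite modulusM modulus_real_scalar ler_wpM2l// rnorm_lattice.
  by apply: (lq_norm_coord (a := fun t => modulus (f t))) => // t; exact: modulus_ge0.
rewrite ler_wpM2r ?rnorm_ge0// [leRHS](bigD1 w)//= lerDl sumr_ge0// => v _.
by rewrite sumr_ge0.
Qed.

Lemma kernel_op_rank r s (a b : 'I_r -> T -> R) : (r <= s)%N ->
  (forall w y, M w y = \sum_(i < r) a i w * b i y) ->
  rank_at_most s kernel_op.
Proof.
move=> rs ME; apply: (rank_at_most_sub
  (v := fun i => ([ffun w => real_scalar F (a i w)] : Y)) rs) => f.
exists (fun i => \sum_y real_scalar F (b i y) * (f : {ffun T -> K^o}) y).
apply/ffunP => w; rewrite sum_ffunE ffunE.
under [RHS]eq_bigr do rewrite !ffunE /GRing.scale/= mulr_suml.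
rewrite exchange_big/=; apply: eq_bigr => y _; rewrite ME.
rewrite (big_morph (real_scalar F) (@real_scalarD R F) (real_scalar0 R F)) mulr_suml.
by apply: eq_bigr => i _; rewrite real_scalarM -mulrA mulrC.
Qed.

Hypothesis M1 : forall t, M t t = 1.

Lemma rnorm_kernel_op_unit_vector_ge1 t :
  1 <= rnorm (kernel_op (unit_vector t)).
Proof.
rewrite rnorm_kernel_op; apply: le_trans (sup_norm_coord _ t).
rewrite (bigD1 t)//= big1 => [|y yt]; last by rewrite ffunE (negPf yt) mulr0.
by rewrite ffunE eqxx mulr1 addr0 modulus_real_scalar M1 normr1.
Qed.

Lemma kernel_op_neq0 : T -> exists f, kernel_op f != 0.
Proof.
move=> t; exists (unit_vector t); apply/eqP => u0.
by have := rnorm_kernel_op_unit_vector_ge1 t; rewrite u0 rnorm0 ler10.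
Qed.

(** The unit vectors have weak l_p norm at most one, and their images have norm at
least one because the kernel is 1 on the diagonal. *)
Lemma pi_summing_kernel_ge : (0 < #|T|)%N ->
  ((#|T|%:R `^ p^-1)%:E <= pi_summing p kernel_op)%E.
Proof.
move=> T0; apply: le_ereal_sup_tmp; exists (pi_summing_m p #|T| kernel_op).
  by exists #|T|.
apply: le_ereal_inf_tmp => _ [c [c0 h] <-].
have := h (fun i => unit_vector (enum_val i)).
move=> /le_trans/(_ (lee_wpmul2l _ weak_lp_norm_unit_vectors)).
rewrite mule1 lee_fin => /(_ c0); rewrite !lee_fin; apply: le_trans.
rewrite ge0_ler_powR ?invr_ge0 ?nnegrE ?sumr_ge0 ?(ltW p0)//.
  by move=> i _; exact: powR_ge0.
rewrite -[X in X%:R]card_ord -sum1_card natr_sum; apply: ler_sum => i _.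
by rewrite -[leLHS](one_powR p) ge0_ler_powR ?nnegrE ?rnorm_ge0 ?(ltW p0)// rnorm_kernel_op_unit_vector_ge1.
Qed.

Lemma pi_summing_m_kernel_le m (c : R) : 0 < c ->
  (forall (W : R) (x : 'I_m -> T -> K), 0 <= W -> weakly_bounded W x ->
    \sum_i sup_norm (fun w => modulus (\sum_y real_scalar F (M w y) * x i y)) `^ p
      <= (c * W) `^ p) ->
  (pi_summing_m p m kernel_op <= c%:E)%E.
Proof.
move=> c0 h; apply: ereal_inf_lbound; exists c => //; split; first exact: ltW.
move=> x; have := weak_lp_norm_ge0 x.
case E : (weak_lp_norm p x) => [W| |]; last 2 first.
- by move=> _; rewrite gt0_muley ?lte_fin// leey.
- by rewrite leeNy_eq.
rewrite lee_fin => W0; rewrite -EFinM lee_fin.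
rewrite -[leLHS]/(lq_norm p (fun i => rnorm (kernel_op (x i)))) lq_norm_le ?mulr_ge0 ?(ltW c0)//.
have xW : (weak_lp_norm p x <= W%:E)%E by rewrite E.
apply: le_trans (h W _ W0 (weak_lp_norm_bounded W0 xW)).
by apply: ler_sum => i _; rewrite rnorm_kernel_op.
Qed.

End Duality.

(** * Propagation of smallness for complex polynomials *)

(** The smallness required on one disc of a chain to get smallness [e] on the next. *)
Definition shrink (R : rcfType) (e : R) : R := (e / 4) ^+ 2.

Section Poly.
Variable R : rcfType.
Local Notation C := R[i].
Implicit Types (f : {poly C}) (z c : C).

Lemma normc_ge0 z : 0 <= normc z.
Proof. by case: z => a b /=; exact: sqrtr_ge0. Qed.

Lemma normcX z n : normc (z ^+ n) = normc z ^+ n.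
Proof.
by elim: n => [|n IH]; [rewrite !expr0 normc1|rewrite !exprS normcM IH].
Qed.

Lemma normc_real (r : R) : normc (r%:C)%C = `|r|.
Proof. by rewrite /= expr0n addr0 sqrtr_sqr. Qed.

Lemma normc_nat n : normc (n%:R : C) = n%:R.
Proof. by rewrite -(rmorph_nat (@real_complex R)) normc_real normr_nat. Qed.

Lemma normc_sum (I : Type) (s : seq I) (P : pred I) (F : I -> C) :
  normc (\sum_(i <- s | P i) F i) <= \sum_(i <- s | P i) normc (F i).
Proof.
elim/big_rec2: _ => [|i y x _ yx]; first by rewrite normc0.
by apply: le_trans (le_normcD _ _) _; rewrite lerD2l.
Qed.

(** The roots of X^n - 1 in an algebraically closed field of characteristic 0 are n
distinct roots of unity. *)
Lemma primitive_root_exists n : (0 < n)%N -> exists w : C, n.-primitive_root w.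
Proof.
move=> n0; pose p : {poly C} := 'X^n - 1.
have [r Dp] := closed_field_poly_normal p.
rewrite (monicP _) ?monicXnsubC // scale1r in Dp.
have rn1 : all n.-unity_root r by apply/allP => z; rewrite -root_prod_XsubC -Dp.
have sz_r : (n < (size r).+1)%N.
  by rewrite -(size_prod_XsubC r id) -Dp size_XnsubC.
have [|z] := hasP (has_prim_root n0 rn1 _ sz_r); last by exists z.
by rewrite -separable_prod_XsubC -Dp separable_Xn_sub_1// pnatr_eq0 -lt0n.
Qed.

(** Averaging f(r w^j) w^(-jk) over the powers of a primitive n-th root of unity w,
with n larger than the degree, isolates the k-th coefficient. *)
Lemma cauchy_estimate f (r B : R) : 0 <= r ->
  (forall z, normc z = r -> normc f.[z] <= B) ->
  forall k, normc f`_k * r ^+ k <= B.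
Proof.
move=> r0 fB k; pose n := maxn (size f) k.+1.
have n0 : (0 < n)%N by rewrite /n leq_max orbT.
have kn : (k < n)%N by rewrite /n leq_max leqnn orbT.
have [w wP] := primitive_root_exists n0.
have nw : normc w = 1.
  have : normc w ^+ n = 1 by rewrite -normcX (prim_expr_order wP) normc1.
  by move=> /eqP; rewrite pexpr_eq1 ?normc_ge0// => /eqP.
have nrC : normc (r%:C)%C = r by rewrite normc_real ger0_norm.
have geo m : \sum_(j < n) (w ^+ m) ^+ j = if (n %| m)%N then n%:R else 0.
  rewrite (prim_order_dvd wP); case: eqP => [->|/eqP wm].
    by under eq_bigr do rewrite expr1n; rewrite sumr_const card_ord.
  apply: (mulfI (x := w ^+ m - 1)); first by rewrite subr_eq0.
  by rewrite -subrX1 -exprM mulnC exprM (prim_expr_order wP) expr1n subrr mulr0.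
have E : \sum_(j < n) f.[(r%:C)%C * w ^+ j] * (w ^+ (n - k)) ^+ j =
    n%:R * (f`_k * (r%:C)%C ^+ k).
  transitivity (\sum_(i < n) f`_i * (r%:C)%C ^+ i * \sum_(j < n) (w ^+ (i + (n - k))) ^+ j).
    under [RHS]eq_bigr do rewrite mulr_sumr.
    rewrite exchange_big/=; apply: eq_bigr => j _.
    rewrite (@horner_coef_wide _ n) ?leq_maxl// mulr_suml; apply: eq_bigr => i _.
    by rewrite exprMn -!exprM mulnDl exprD (mulnC j) !mulrA.
  under eq_bigr do rewrite geo.
  rewrite (bigD1 (Ordinal kn))//= subnKC 1?ltnW// dvdnn big1 ?addr0 1?mulrC// => i ik.
  (* Only i = k gives a multiple of n, since 0 < i + (n - k) < 2n. *)
  case: ifP => [/dvdnP[c ic]|_]; last by rewrite mulr0.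
  have iNk : nat_of_ord i <> k by move=> ik'; case/negP: ik; apply/eqP/val_inj.
  have ltin := ltn_ord i.
  case: c ic => [|[|c]]; rewrite ?mul0n ?mul1n ?mulSn; [lia|lia|].
  by move: (c * n)%N => ? ?; lia.
rewrite -(ler_pM2l (x := n%:R)) ?ltr0n//.
have -> : n%:R * (normc f`_k * r ^+ k) = normc (n%:R * (f`_k * (r%:C)%C ^+ k)).
  by rewrite !normcM normc_nat normcX nrC.
rewrite -E; apply: le_trans (normc_sum _ _ _) _.
have -> : n%:R * B = \sum_(j < n) B by rewrite sumr_const card_ord mulr_natl.
apply: ler_sum => j _; rewrite normcM !normcX nw !expr1n mulr1.
by apply: fB; rewrite normcM normcX nw expr1n mulr1.
Qed.

Lemma geometric34 n : \sum_(k < n) (3 / 4 : R) ^+ k <= 4.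
Proof.
have -> : \sum_(k < n) (3 / 4 : R) ^+ k = 4 - 4 * (3 / 4) ^+ n.
  elim: n => [|n IH]; first by rewrite big_ord0 expr0; lra.
  by rewrite big_ord_recr /= IH exprS; lra.
by rewrite gerBl mulr_ge0// exprn_ge0//; lra.
Qed.

(** Multiplying the two Cauchy estimates on the discs of radius rho and rho/4 bounds
the k-th coefficient of the rescaled polynomial by eta 2^k, and 2 * 3/8 < 1 makes
the resulting series geometric. *)
Lemma three_disc f c (rho eta : R) : 0 < rho -> 0 <= eta ->
  (forall z, normc (z - c) <= rho -> normc f.[z] <= 1) ->
  (forall z, normc (z - c) <= rho / 4 -> normc f.[z] <= eta ^+ 2) ->
  forall z, normc (z - c) <= 3 / 8 * rho -> normc f.[z] <= 4 * eta.
Proof.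
move=> rho0 eta0 f1 f2 z zc.
pose rC := (rho%:C)%C; pose g := f \Po (rC *: 'X + c%:P).
have nrC : normc rC = rho by rewrite normc_real gtr0_norm.
have rN0 : rC != 0 by apply/eqP => /(congr1 (@normc R)); rewrite nrC normc0; lra.
have gE w : g.[w] = f.[rC * w + c] by rewrite horner_comp !hornerE.
have g1 k : normc g`_k <= 1.
  rewrite -[leLHS]mulr1 -[X in _ * X](expr1n _ k).
  apply: cauchy_estimate => // w w1; rewrite gE; apply: f1.
  by rewrite addrK normcM nrC w1 mulr1.
have g2 k : normc g`_k <= eta ^+ 2 * 4 ^+ k.
  rewrite -ler_pdivrMr ?exprn_gt0// -exprVn.
  apply: cauchy_estimate => [|w w1]; first by rewrite invr_ge0.
  rewrite gE; apply: f2.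
  by rewrite addrK normcM nrC w1.
have gk k : normc g`_k <= eta * 2 ^+ k.
  rewrite -(ler_pXn2r (ltn0Sn 1)) ?nnegrE ?normc_ge0 ?mulr_ge0 ?exprn_ge0//.
  rewrite exprMn -exprM mulnC exprM (_ : 2 ^+ 2 = 4); last by ring.
  rewrite -[leRHS]mul1r expr2; apply: ler_pM; rewrite ?normc_ge0//.
pose w := rC^-1 * (z - c).
have w38 : normc w <= 3 / 8 by rewrite normcM normcV nrC ler_pdivrMl// mulrC.
have -> : z = rC * w + c by rewrite mulVKf// subrK.
rewrite -gE horner_coef; apply: le_trans (normc_sum _ _ _) _.
apply: le_trans (_ : \sum_(k < size g) eta * (3 / 4) ^+ k <= _); last first.
  by rewrite -mulr_sumr mulrC ler_wpM2r// geometric34.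
apply: ler_sum => k _; rewrite normcM normcX.
apply: le_trans (_ : eta * 2 ^+ k * (3 / 8) ^+ k <= _).
  by apply: ler_pM; rewrite ?normc_ge0 ?exprn_ge0 ?normc_ge0//; apply: lerXn2r; rewrite ?nnegrE ?normc_ge0//; lra.
by rewrite -mulrA -exprMn (_ : 2 * (3 / 8) = 3 / 4 :> R)//; lra.
Qed.

(** The discs of radius 1/J around the points x j, which descend from 1/2 to 0 in J
equal steps, form a chain: each is contained in the disc of radius 3/8 * 4/J around
the previous centre, where [three_disc] applies. *)
Lemma propagation (J : nat) f (eta : R) : (0 < J)%N -> 0 <= eta ->
  (forall (x : R) z, 0 <= x <= 1 / 2 -> normc (z - (x%:C)%C) <= 4 / J%:R ->
     normc f.[z] <= 1) ->
  (forall z, normc (z - ((1 / 2)%:C)%C) <= 1 / J%:R ->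
     normc f.[z] <= iter J (@shrink R) eta) ->
  normc f.[0] <= eta.
Proof.
move=> J0 eta0 f1 f2.
have JR : 0 < J%:R :> R by rewrite ltr0n.
pose x j : R := 1 / 2 * (1 - j%:R / J%:R).
have it0 n : 0 <= iter n (@shrink R) eta by case: n => //= n; exact: sqr_ge0.
have chain j : (j <= J)%N -> forall z, normc (z - ((x j)%:C)%C) <= 1 / J%:R ->
    normc f.[z] <= iter (J - j) (@shrink R) eta.
  elim: j => [_ z|j IH jJ z zx].
    by rewrite /x mul0r subr0 mulr1 subn0; exact: f2.
  have {}IH := IH (ltnW jJ).
  have -> : iter (J - j.+1) (@shrink R) eta =
      4 * (iter (J - j.+1) (@shrink R) eta / 4) by field.
  apply: (@three_disc f ((x j)%:C)%C (4 / J%:R)).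
  - by rewrite divr_gt0.
  - by rewrite divr_ge0.
  - move=> y; apply: f1; rewrite /x.
    have a0 : 0 <= j%:R / J%:R :> R by rewrite divr_ge0.
    have a1 : j%:R / J%:R <= 1 :> R by rewrite ler_pdivrMr// mul1r ler_nat ltnW.
    by move: (j%:R / J%:R) a0 a1 => a a0 a1; apply/andP; split; lra.
  - move=> y yx; have -> : (iter (J - j.+1) (@shrink R) eta / 4) ^+ 2 =
        iter (J - j) (@shrink R) eta.
      by rewrite -[RHS]/(iter (J - j) _ _) -(subnSK jJ).
    by apply: IH; apply: le_trans yx _; rewrite mulrAC divff ?pnatr_eq0.
  - have -> : z - (x j)%:C%C = (z - (x j.+1)%:C%C) + ((x j.+1 - x j)%:C)%C by rewrite rmorphB addrA subrK.
    apply: le_trans (le_normcD _ _) _; rewrite normc_real.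
    have -> : x j.+1 - x j = - (1 / 2 / J%:R) by rewrite /x -natr1; field; rewrite gt_eqF.
    rewrite normrN ger0_norm ?divr_ge0//; last by lra.
have xJ : x J = 0 by rewrite /x divff ?gt_eqF// subrr mulr0.
have := chain J (leqnn J) 0; rewrite subnn xJ; apply.
by rewrite rmorph0 subrr normc0 divr_ge0.
Qed.

End Poly.

(** * Factorable kernels *)

Section Kernels.
Variables (R : realType) (p q : R).
Hypotheses (p0 : 0 < p) (q0 : 0 < q) (pq : p^-1 + q^-1 = 1).
Local Notation C := R[i].
Implicit Types T A : finType.

(** For [c = 1] this is a Pietsch factorization: the rows [f a] spread over T have
total p-th power at most the number of points, and the coefficients of each row of
[Phi] lie in the unit ball of l_q. Letting the constant [c] scale both conditions
makes the class additive in [c]. *)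
Definition factorable T (c : R) (Phi : T -> T -> C) : Prop :=
  exists (A : finType) (psi : T -> A -> C) (f : A -> T -> C),
    [/\ forall w y, Phi w y = \sum_a psi w a * f a y,
        \sum_a \sum_y normc (f a y) `^ p <= c * #|T|%:R &
        forall w, \sum_a normc (psi w a) `^ q <= c].

Lemma normc_powR0 (r : R) : 0 < r -> normc (0 : C) `^ r = 0.
Proof. by move=> r0; rewrite normc0 powR0// gt_eqF. Qed.

Lemma factorable_ext T c (Phi Psi : T -> T -> C) :
  (forall w y, Phi w y = Psi w y) -> factorable c Phi -> factorable c Psi.
Proof.
by move=> E [A [psi [f [h1 h2 h3]]]]; exists A, psi, f; split=> // w y; rewrite -E.
Qed.

Lemma factorable_add T c d (Phi Psi : T -> T -> C) :
  factorable c Phi -> factorable d Psi ->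
  factorable (c + d) (fun w y => Phi w y + Psi w y).
Proof.
move=> [A [psi [f [h1 h2 h3]]]] [B [chi [g [k1 k2 k3]]]].
exists (A + B)%type, (fun w s => match s with inl a => psi w a | inr b => chi w b end),
  (fun s => match s with inl a => f a | inr b => g b end); split=> [w y||w].
- by rewrite big_sumType/= h1 k1.
- by rewrite big_sumType/= mulrDl lerD.
- by rewrite big_sumType/= lerD.
Qed.

Lemma factorable_scale T c d (Phi : T -> T -> C) : 0 <= d ->
  factorable c Phi -> factorable (d * c) (fun w y => (d%:C)%C * Phi w y).
Proof.
move=> d0 [A [psi [f [h1 h2 h3]]]].
have powE (r : R) (z : C) : 0 < r ->
    normc (((d `^ r^-1)%:C)%C * z) `^ r = d * normc z `^ r.
  move=> r0; rewrite normcM normc_real ger0_norm ?powR_ge0// powRM ?powR_ge0 ?normc_ge0//.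
  by rewrite powR_invK// gt_eqF.
exists A, (fun w a => ((d `^ q^-1)%:C)%C * psi w a),
  (fun a y => ((d `^ p^-1)%:C)%C * f a y); split=> [w y||w].
- rewrite h1 mulr_sumr; apply: eq_bigr => a _.
  rewrite mulrACA -rmorphM -powRD ?(addrC q^-1) ?pq ?oner_eq0//.
  by rewrite powRr1.
- under eq_bigr do under eq_bigr do rewrite powE//.
  by under eq_bigr do rewrite -mulr_sumr; rewrite -mulr_sumr -mulrA ler_wpM2l.
- by under eq_bigr do rewrite powE//; rewrite -mulr_sumr ler_wpM2l.
Qed.

Lemma factorable_rank1 T (chi : T -> C) : (forall w, normc (chi w) = 1) ->
  factorable 1 (fun w y => chi w * chi y).
Proof.
move=> chi1; exists unit, (fun w _ => chi w), (fun _ => chi); split=> [w y||w].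
- by rewrite big_const card_unit/= addr0.
- rewrite big_const card_unit/= addr0 mul1r.
  under eq_bigr do rewrite chi1 one_powR.
  by rewrite sumr_const.
- by rewrite big_const card_unit/= addr0 chi1 one_powR.
Qed.

Lemma factorable0 T : factorable 0 (fun _ _ : T => 0).
Proof.
have := factorable_scale (lexx 0) (@factorable_rank1 T (fun=> 1) (fun=> normc1 R)).
by rewrite mul0r; apply: factorable_ext => w y; rewrite mul0r.
Qed.

Lemma factorable_sum T (I : finType) (c : I -> R) (Phi : I -> T -> T -> C) :
  (forall i, factorable (c i) (Phi i)) ->
  factorable (\sum_i c i) (fun w y => \sum_i Phi i w y).
Proof.
move=> h; elim: (index_enum I) => [|i s IH].
  by rewrite big_nil; apply: factorable_ext (factorable0 T) => w y; rewrite big_nil.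
rewrite big_cons; apply: factorable_ext (factorable_add (h i) IH) => w y.
by rewrite big_cons.
Qed.

Definition id_kernel T (w y : T) : C := (w == y)%:R.

Lemma factorable_id T : factorable 1 (@id_kernel T).
Proof.
exists T, (fun w a => id_kernel w a), (fun a y => id_kernel a y).
have sum1 (a : T) : \sum_y normc (id_kernel a y) `^ p = 1 :> R.
  rewrite (bigD1 a)//= /id_kernel eqxx normc1 one_powR big1 ?addr0// => y ya.
  by rewrite eq_sym (negPf ya) normc_powR0.
split=> [w y||w].
- rewrite (bigD1 w)//= {2}/id_kernel eqxx mul1r big1 ?addr0// => y' yw.
  by rewrite {1}/id_kernel eq_sym (negPf yw) mul0r.
- by rewrite (eq_bigr _ (fun a _ => sum1 a)) sumr_const mul1r.
- rewrite (bigD1 w)//= /id_kernel eqxx normc1 one_powR big1 ?addr0// => y ya.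
  by rewrite eq_sym (negPf ya) normc_powR0.
Qed.

(** Padding by zeros gives two kernels the same index type, so that tensor products
mixing them need no dependent products. *)
Lemma factorable_common T c (Phi : bool -> T -> T -> C) :
  (forall b, factorable c (Phi b)) ->
  exists (A : finType) (psi : bool -> T -> A -> C) (f : bool -> A -> T -> C), forall b,
    [/\ forall w y, Phi b w y = \sum_a psi b w a * f b a y,
        \sum_a \sum_y normc (f b a y) `^ p <= c * #|T|%:R &
        forall w, \sum_a normc (psi b w a) `^ q <= c].
Proof.
move=> h; have [A [psi [f [h1 h2 h3]]]] := h true.
have [B [chi [g [k1 k2 k3]]]] := h false.
exists (A + B)%type,
  (fun b w s => match s with inl a => if b then psi w a else 0
                           | inr a => if b then 0 else chi w a end),
  (fun b s => match s with inl a => fun y => if b then f a y else 0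
                         | inr a => fun y => if b then 0 else g a y end).
case; split=> [w y||w]; rewrite big_sumType/=.
- by rewrite [X in _ + X]big1 ?addr0// => a _; rewrite mul0r.
- rewrite [X in _ + X]big1 ?addr0// => a _.
  by rewrite big1// => y _; rewrite normc_powR0.
- by rewrite [X in _ + X]big1 ?addr0// => a _; rewrite normc_powR0.
- by rewrite big1 ?add0r// => a _; rewrite mul0r.
- rewrite big1 ?add0r// => a _.
  by rewrite big1// => y _; rewrite normc_powR0.
- by rewrite big1 ?add0r// => a _; rewrite normc_powR0.
Qed.

Lemma normc_prod_powR (I : finType) (g : I -> C) r :
  normc (\prod_i g i) `^ r = \prod_i normc (g i) `^ r.
Proof.
elim: (index_enum I) => [|i s IH]; first by rewrite !big_nil normc1 one_powR.
by rewrite !big_cons normcM powRM ?normc_ge0// IH.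
Qed.

(** Both sums of p-th and q-th powers are multiplicative. *)
Lemma factorable_tensor T n (Phi : bool -> T -> T -> C) (S : {set 'I_n}) :
  (forall b, factorable 1 (Phi b)) ->
  factorable 1 (fun w y : {ffun 'I_n -> T} => \prod_j Phi (j \in S) (w j) (y j)).
Proof.
move=> /factorable_common[A [psi [f h]]].
exists {ffun 'I_n -> A}, (fun (w : {ffun 'I_n -> T}) (a : {ffun 'I_n -> A}) => \prod_j psi (j \in S) (w j) (a j)),
  (fun (a : {ffun 'I_n -> A}) (y : {ffun 'I_n -> T}) => \prod_j f (j \in S) (a j) (y j)); split=> [w y||w].
- under eq_bigr => j _ do have [-> _ _] := h (j \in S).
  rewrite bigA_distr_bigA/=; apply: eq_bigr => a _.
  by rewrite big_split.
- under eq_bigr do under eq_bigr do rewrite normc_prod_powR.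
  under eq_bigr => a _ do rewrite -(bigA_distr_bigA (fun j y => normc (f (j \in S) (a j) y) `^ p)).
  rewrite -(bigA_distr_bigA (fun j a => \sum_y normc (f (j \in S) a y) `^ p)) mul1r.
  rewrite card_ffun card_ord natrX -[X in _ ^+ X](card_ord n) -prodr_const.
  apply: ler_prod => j _; have [_ h2 _] := h (j \in S).
  by rewrite -[_%:R]mul1r h2 sumr_ge0// => a _; rewrite sum_powR_ge0.
- under eq_bigr do rewrite normc_prod_powR.
  rewrite -(bigA_distr_bigA (fun j a => normc (psi (j \in S) (w j) a) `^ q)).
  apply: prodr_ile1 => j _; have [_ _ h3] := h (j \in S).
  by rewrite h3 andbT sum_powR_ge0.
Qed.

(** This is the bound of the p-summing norm in bilinear form: insert the
factorization and apply Hoelder's inequality over the pairs of a vector and an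
index; the weak bound is used once for each row [f a]. *)
Lemma factorable_pairing T m (Phi : T -> T -> C) (x : 'I_m -> T -> C) (W V : R)
    (v : 'I_m -> C) (w : 'I_m -> T) :
  factorable 1 Phi -> 0 <= W -> 0 <= V ->
  (forall g : T -> C, \sum_i normc (\sum_t g t * x i t) `^ p <=
     W `^ p * \sum_t normc (g t) `^ p) ->
  \sum_i normc (v i) `^ q <= V `^ q ->
  normc (\sum_i v i * \sum_y Phi (w i) y * x i y) <= V * (W * #|T|%:R `^ p^-1).
Proof.
move=> [A [psi [f [h1 h2 h3]]]] W0 V0 xW vV.
have -> : \sum_i v i * \sum_y Phi (w i) y * x i y =
    \sum_(s : 'I_m * A) v s.1 * psi (w s.1) s.2 * \sum_y f s.2 y * x s.1 y.
  rewrite -(pair_bigA _ (fun i a => v i * psi (w i) a * \sum_y f a y * x i y))/=.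
  apply: eq_bigr => i _; under eq_bigr do rewrite h1 mulr_suml.
  rewrite exchange_big/= mulr_sumr; apply: eq_bigr => a _.
  by rewrite -mulrA; congr (_ * _); rewrite mulr_sumr; apply: eq_bigr => y _; rewrite mulrA.
apply: le_trans (normc_sum _ _ _) _; under eq_bigr do rewrite normcM.
have qp : q^-1 + p^-1 = 1 by rewrite addrC.
apply: (hoelder_sum q0 p0 qp) => //.
- by move=> t; exact: normc_ge0.
- by move=> t; exact: normc_ge0.
- by rewrite mulr_ge0// powR_ge0.
- apply: le_trans vV.
  rewrite -(pair_bigA _ (fun i a => normc (v i * psi (w i) a) `^ q))/=.
  apply: ler_sum => i _.
  under eq_bigr do rewrite normcM powRM ?normc_ge0//.
  by rewrite -mulr_sumr ler_piMr// powR_ge0.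
- rewrite powRM ?powR_ge0// powR_invK ?gt_eqF//.
  rewrite -(pair_bigA _ (fun i a => normc (\sum_y f a y * x i y) `^ p))/=.
  rewrite exchange_big/=.
  apply: le_trans (_ : \sum_a W `^ p * \sum_y normc (f a y) `^ p <= _).
    by apply: ler_sum => a _; exact: xW.
  by rewrite -mulr_sumr ler_wpM2l ?powR_ge0// -[leRHS]mul1r.
Qed.

End Kernels.

(** * Directions preserving factorability *)

Section BooleanFourier.
Variable K : numFieldType.
Implicit Types f g : bool -> bool -> K.

(** Unnormalised Walsh coefficients on the group of order 4. *)
Definition fourier (s t : bool) f : K :=
  f false false + (-1) ^+ t * f false true + (-1) ^+ s * f true false +
  (-1) ^+ (s (+) t) * f true true.

(** Convolution on the group of order 4 multiplies Walsh coefficients. *)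
Lemma fourier_convolution f g (a b c d : bool) :
  g (true (+) a) (true (+) b) * f (true (+) c) (true (+) d) +
  g (true (+) a) (false (+) b) * f (true (+) c) (false (+) d) +
  (g (false (+) a) (true (+) b) * f (false (+) c) (true (+) d) +
   g (false (+) a) (false (+) b) * f (false (+) c) (false (+) d)) =
  4^-1 * (fourier false false f * fourier false false g +
    fourier true false f * fourier true false g * ((-1) ^+ a * (-1) ^+ c) +
    fourier false true f * fourier false true g * ((-1) ^+ b * (-1) ^+ d) +
    fourier true true f * fourier true true g *
      ((-1) ^+ (a (+) b) * (-1) ^+ (c (+) d))).
Proof.
rewrite /fourier; case: a; case: b; case: c; case: d; rewrite /= ?expr0 ?expr1;
move: (f true true) (f true false) (f false true) (f false false)
  (g true true) (g true false) (g false true) (g false false)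
  => f1 f2 f3 f4 g1 g2 g3 g4; by field.
Qed.

Lemma fourier_parseval f g :
  g true true * f true true + g true false * f true false +
  (g false true * f false true + g false false * f false false) =
  4^-1 * (fourier false false f * fourier false false g +
    fourier true false f * fourier true false g +
    fourier false true f * fourier false true g +
    fourier true true f * fourier true true g).
Proof.
have := fourier_convolution f g false false false false.
by rewrite /= expr0 !mulr1.
Qed.

Lemma split_at_diagonal (x0 x1 x2 x3 y0 y1 y2 y3 e1 e2 e3 : K) :
  4^-1 * (x0 * y0 + x1 * y1 * e1 + x2 * y2 * e2 + x3 * y3 * e3) =
  4^-1 * (x0 * y0 + x1 * y1 + x2 * y2 + x3 * y3) +
  (4^-1 * x1 * y1 * (e1 - 1) + 4^-1 * x2 * y2 * (e2 - 1) + 4^-1 * x3 * y3 * (e3 - 1)).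
Proof. by ring. Qed.

Lemma fourier_one_variable (u v : K) :
  let f := fun a _ : bool => if a then u else 1 in
  let g := fun a _ : bool => if a then v else 1 in
  [/\ 4^-1 * fourier true false f * fourier true false g = (1 - u) * (1 - v),
      fourier false true f = 0 & fourier true true f = 0].
Proof. by rewrite /fourier /= ?expr0 ?expr1; split; field. Qed.

Lemma fourier_diagonal (b c b' c' : K) :
  let f := fun s t : bool => if s (+) t then b else if s then 0 else c in
  let g := fun s t : bool => if s (+) t then b' else if s then 0 else c' in
  4^-1 * fourier true true f * fourier true true g =
    4^-1 * (c - 2 * b) * (c' - 2 * b').
Proof. by rewrite /fourier /= ?expr0 ?expr1; field. Qed.

End BooleanFourier.

Section SignKernels.
Variables (R : realType) (p q : R).
Hypotheses (p1 : 1 < p) (q1 : 1 < q) (pq : p^-1 + q^-1 = 1).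
Local Notation C := R[i].
Let p0 : 0 < p. Proof. exact: lt_trans p1. Qed.
Let q0 : 0 < q. Proof. exact: lt_trans q1. Qed.
Variable T : finType.
Local Notation factorable := (factorable p q).

Definition sgn (b : bool) : C := (-1) ^+ b.
Definition sign_kernel (chi : T -> bool) (w y : T) : C := sgn (chi w) * sgn (chi y).

Lemma sgn_addb a b : sgn (a (+) b) = sgn a * sgn b.
Proof. by rewrite /sgn signr_addb. Qed.

Lemma normc_sgn b : normc (sgn b) = 1.
Proof. by rewrite normcX normcN normc1 expr1n. Qed.

Lemma factorable_sign chi : factorable 1 (sign_kernel chi).
Proof. by apply: factorable_rank1 => w; exact: normc_sgn. Qed.

(** The duality map of l_p, whose value at [u] has modulus |u|^(p-1). *)
Definition dual_value (u : C) : C := u^*%C * ((normc u `^ (p - 2))%:C)%C.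

Lemma dual_value0 : dual_value 0 = 0.
Proof. by rewrite /dual_value conjc0 mul0r. Qed.

Lemma normc_gt0 (u : C) : u != 0 -> 0 < normc u.
Proof.
by move=> uN0; rewrite lt_def normc_ge0 andbT; apply: contraNneq uN0 => /eq0_normc ->.
Qed.

Lemma dual_valueM u : u * dual_value u = ((normc u `^ p)%:C)%C.
Proof.
have [->|/normc_gt0 u0] := eqVneq u 0.
  by rewrite mul0r normc0 powR0 ?gt_eqF.
have -> : normc u `^ p = normc u ^+ 2 * normc u `^ (p - 2).
  rewrite -powR_mulrn ?normc_ge0// -powRD ?(gt_eqF u0) ?implybT//.
  by congr (_ `^ _); ring.
rewrite /dual_value mulrA -sqr_normc rmorphM rmorphXn /=.
by congr (_ ^+ 2 * _); case: u {u0}.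
Qed.

Lemma normc_dual_value u : normc (dual_value u) `^ q = normc u `^ p.
Proof.
have [->|uN0] := eqVneq u 0.
  by rewrite dual_value0 normc0 !powR0 ?gt_eqF.
have u0 := normc_gt0 uN0.
have -> : normc (dual_value u) = normc u `^ (p - 1).
  apply: (mulfI (lt0r_neq0 u0)); rewrite -normcM dual_valueM normc_real.
  by rewrite ger0_norm ?powR_ge0// mulr_powRB1// ltW.
by rewrite -powRrM conjugate_exponent.
Qed.

Lemma dual_value_real (r : R) : 0 <= r -> dual_value ((r%:C)%C) = ((r `^ (p - 1))%:C)%C.
Proof.
rewrite le_eqVlt => /predU1P[<-|r0].
  by rewrite dual_value0 powR0// subr_eq0 gt_eqF.
have rN0 : (r%:C)%C != 0 :> C.
  by apply/eqP => /(congr1 (@normc R)); rewrite normc_real normc0 gtr0_norm// => /eqP; rewrite gt_eqF.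
apply: (mulfI rN0); rewrite dual_valueM normc_real ger0_norm ?ltW// -rmorphM/=.
by rewrite mulr_powRB1// ltW.
Qed.

Lemma sum_bool2 (V : nmodType) (g : bool * bool -> V) : \sum_ab g ab =
  g (true, true) + g (true, false) + (g (false, true) + g (false, false)).
Proof.
rewrite (eq_bigr (fun ab => g (ab.1, ab.2))) => [|[] //].
by rewrite -(pair_bigA _ (fun a b => g (a, b)))/= !big_bool.
Qed.

(** Translating [f] and its dual function along the characters [chi] and [chi']
gives a factorable kernel; by [fourier_convolution] it is a combination of the four
sign kernels generated by them. *)
Lemma factorable_pair (chi chi' : T -> bool) (f : bool -> bool -> C) :
  let g a b := dual_value (f a b) in
  factorable (\sum_ab normc (f ab.1 ab.2) `^ p)
    (fun w y => 4^-1 * (fourier false false f * fourier false false g +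
      fourier true false f * fourier true false g * sign_kernel chi w y +
      fourier false true f * fourier false true g * sign_kernel chi' w y +
      fourier true true f * fourier true true g *
        sign_kernel (fun w => chi w (+) chi' w) w y)).
Proof.
move=> g.
exists (bool * bool)%type, (fun w ab => g (ab.1 (+) chi w) (ab.2 (+) chi' w)),
  (fun ab y => f (ab.1 (+) chi y) (ab.2 (+) chi' y)).
have shift (h : bool -> bool -> R) s t :
    \sum_ab h (ab.1 (+) s) (ab.2 (+) t) = \sum_ab h ab.1 ab.2.
  rewrite !sum_bool2; case: s; case: t => /=; ring.
split=> [w y||w].
- by rewrite sum_bool2 -fourier_convolution.
- rewrite exchange_big/=.
  under eq_bigr do rewrite (shift (fun a b => normc (f a b) `^ p)).
  by rewrite sumr_const mulr_natr.
- under eq_bigr do rewrite normc_dual_value.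
  by rewrite (shift (fun a b => normc (f a b) `^ p)).
Qed.

Lemma sum_pair (f : bool -> bool -> C) :
  let g a b := dual_value (f a b) in
  ((\sum_ab normc (f ab.1 ab.2) `^ p)%:C)%C =
   4^-1 * (fourier false false f * fourier false false g +
      fourier true false f * fourier true false g +
      fourier false true f * fourier false true g +
      fourier true true f * fourier true true g).
Proof.
move=> g; rewrite rmorph_sum/=; under eq_bigr do rewrite -dual_valueM.
rewrite sum_bool2.
rewrite -fourier_parseval.
by congr (_ + _ + (_ + _)); exact: mulrC.
Qed.

Variables (n : nat) (gen : 'I_n.+1 -> T -> bool).
Hypothesis gen0 : forall w, gen ord0 w = false.

Definition combination (c : 'I_n.+1 -> R) (w y : T) : C :=
  \sum_k ((c k)%:C)%C * sign_kernel (gen k) w y.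

(** [V] is a direction that can be absorbed by a nonnegative combination of the
generating sign kernels. All kernels [V] considered vanish on the diagonal, so the
constant is the diagonal value of the sum. *)
Definition direction (V : T -> T -> C) : Prop :=
  exists c : 'I_n.+1 -> R, (forall k, 0 <= c k) /\
    factorable (\sum_k c k) (fun w y => combination c w y + V w y).

Lemma direction_ext V U : (forall w y, V w y = U w y) -> direction V -> direction U.
Proof.
move=> E [c [c0 h]]; exists c; split=> //; apply: factorable_ext h => w y.
by rewrite E.
Qed.

Lemma combinationD c d w y :
  combination (fun k => c k + d k) w y = combination c w y + combination d w y.
Proof.
by rewrite -big_split; apply: eq_bigr => k _; rewrite rmorphD/= mulrDl.
Qed.

Lemma combinationZ r c w y :
  combination (fun k => r * c k) w y = (r%:C)%C * combination c w y.
Proof.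
by rewrite mulr_sumr; apply: eq_bigr => k _; rewrite rmorphM/= mulrA.
Qed.

Lemma direction_add V U : direction V -> direction U ->
  direction (fun w y => V w y + U w y).
Proof.
move=> [c [c0 h]] [d [d0 k]]; exists (fun i => c i + d i); split.
  by move=> i; rewrite addr_ge0.
rewrite big_split/=; apply: factorable_ext (factorable_add h k) => w y.
by rewrite combinationD addrACA.
Qed.

Lemma direction_scale (r : R) V : 0 <= r -> direction V ->
  direction (fun w y => (r%:C)%C * V w y).
Proof.
move=> r0 [c [c0 h]]; exists (fun i => r * c i); split.
  by move=> i; rewrite mulr_ge0.
rewrite -mulr_sumr; apply: factorable_ext (factorable_scale p0 q0 pq r0 h) => w y.
by rewrite combinationZ mulrDr.
Qed.

(** The coefficient vector concentrated at [k]. *)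
Definition point (k : 'I_n.+1) (i : 'I_n.+1) : R := (i == k)%:R.

Lemma sum_point k : \sum_i point k i = 1.
Proof.
rewrite (bigD1 k)//= /point eqxx big1 ?addr0// => i /negPf ->//.
Qed.

Lemma combination_point k w y : combination (point k) w y = sign_kernel (gen k) w y.
Proof.
rewrite /combination (bigD1 k)//= /point eqxx mul1r big1 ?addr0// => i /negPf ->.
by rewrite mul0r.
Qed.

Lemma combination_point0 w y : combination (point ord0) w y = 1.
Proof. by rewrite combination_point /sign_kernel !gen0 mulr1. Qed.

Lemma direction_of_factorable (c : R) V : 0 <= c ->
  factorable c (fun w y => (c%:C)%C + V w y) -> direction V.
Proof.
move=> c0 h; exists (fun i => c * point ord0 i); split.
  by move=> i; rewrite mulr_ge0// /point ler0n.
rewrite -mulr_sumr sum_point mulr1; apply: factorable_ext h => w y.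
by rewrite combinationZ combination_point0 mulr1.
Qed.

Definition ray (z : C) (chi : T -> bool) (w y : T) : C := z * (sign_kernel chi w y - 1).

(** Subtract from the kernel of [factorable_pair] its constant diagonal value. *)
Lemma direction_pair (chi chi' : T -> bool) (f : bool -> bool -> C) :
  let g a b := dual_value (f a b) in
  direction (fun w y =>
    ray (4^-1 * fourier true false f * fourier true false g) chi w y +
    ray (4^-1 * fourier false true f * fourier false true g) chi' w y +
    ray (4^-1 * fourier true true f * fourier true true g)
        (fun w => chi w (+) chi' w) w y).
Proof.
move=> g; apply: (@direction_of_factorable (\sum_ab normc (f ab.1 ab.2) `^ p)).
  by apply: sumr_ge0 => ab _; exact: powR_ge0.
apply: factorable_ext (factorable_pair chi chi' f) => w y.
by rewrite split_at_diagonal sum_pair.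
Qed.

(** Characters along which every complex multiple can be absorbed. *)
Definition free (chi : T -> bool) := forall z, direction (ray z chi).

Lemma direction_positive (chi : T -> bool) : direction (ray 1 chi).
Proof.
apply: (@direction_of_factorable 1) => //.
by apply: factorable_ext (factorable_sign chi) => w y; rewrite /ray mul1r subrKC.
Qed.

Lemma direction0 : direction (fun _ _ => 0).
Proof.
exists (fun=> 0); split=> //; rewrite big1//.
apply: factorable_ext (factorable0 p0 q0 pq T) => w y.
by rewrite /combination big1 ?addr0// => k _; rewrite mul0r.
Qed.

Lemma ray_scale (r : R) z chi : 0 <= r -> direction (ray z chi) ->
  direction (ray ((r%:C)%C * z) chi).
Proof.
move=> r0 /(direction_scale r0); apply: direction_ext => w y.
by rewrite /ray mulrA.
Qed.

Lemma ray_add z z' chi : direction (ray z chi) -> direction (ray z' chi) ->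
  direction (ray (z + z') chi).
Proof.
move=> h /(direction_add h); apply: direction_ext => w y.
by rewrite /ray mulrDl.
Qed.

Hypothesis p2 : p != 2.
Let kappa : R := 2 `^ (p - 1).

Let kappaN2 : kappa != 2.
Proof.
apply/eqP => /(congr1 (@ln R)); rewrite ln_powR -[RHS]mul1r => /mulIf.
have ln2 : ln 2 != 0 :> R by rewrite gt_eqF// ln_gt0// ltr1n.
by move=> /(_ ln2) /eqP; rewrite subr_eq (_ : 1 + 1 = 2)//; exact/negP.
Qed.

(** The function with values 1 and 2i, or 1 and -2i, on the two classes of [chi].
Its dual function has values 1 and -i kappa, or 1 and i kappa, so the imaginary
part of the product of the coefficients is kappa - 2 up to sign; it is not 0
because 2^(p-1) = 2 only for p = 2. *)
Lemma direction_imaginary (chi : T -> bool) (s : bool) :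
  direction (ray ((1 + 2 * kappa) +i* ((-1) ^+ s * (kappa - 2)))%C chi).
Proof.
pose e : R := (-1) ^+ s.
have ee : e * e = 1 by rewrite -expr2 sqrr_sign.
pose u : C := (0 +i* (e * 2))%C; pose v : C := (0 +i* (- (e * kappa)))%C.
have nu : normc u = 2.
  by rewrite /= expr0n add0r exprMn [e ^+ 2]expr2 ee mul1r sqrtr_sqr ger0_norm.
have uv : dual_value u = v.
  rewrite /dual_value nu; apply/eqP; rewrite eq_complex /=; apply/andP; split; apply/eqP.
    by rewrite mul0r mulr0 subr0.
  rewrite !(mul0r, mulr0, add0r, addr0) mulNr; congr (- _); rewrite -mulrA; congr (_ * _).
  rewrite /kappa -[X in X * _]powRr1// -powRD ?pnatr_eq0 ?implybT//.
  by congr (_ `^ _); ring.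
have := direction_pair chi (fun=> false) (fun a _ => if a then u else 1).
rewrite /=.
have -> : (fun a b : bool => dual_value (if a then u else 1)) =
          (fun a b : bool => if a then v else 1).
  apply/funext => a; apply/funext => b; case: a => //.
  by have := dual_value_real (ler01 : 0 <= 1 :> R); rewrite one_powR.
have [-> -> ->] := fourier_one_variable u v; apply: direction_ext => w y.
rewrite /ray !(mulr0, mul0r) !addr0; congr (_ * _).
apply/eqP; rewrite eq_complex /= -/e; apply/andP; split; apply/eqP; rewrite !subr0.
  have -> : (0 - e * 2) * (0 - - (e * kappa)) = - (2 * kappa) * (e * e) by ring.
  by rewrite ee; ring.
by ring.
Qed.

(** With one negative multiple all real ones are available; a positive multiple of
one of the two conjugate directions of [direction_imaginary] then corrects the
imaginary part. *)
Lemma free_of_negative chi (d : R) : d < 0 ->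
  direction (ray (d%:C)%C chi) -> free chi.
Proof.
move=> d0 hd.
have real (r : R) : direction (ray (r%:C)%C chi).
  have [r0|r0] := leP 0 r.
    by have := ray_scale r0 (direction_positive chi); rewrite mulr1.
  have : 0 <= r / d by rewrite mulr_le0 ?invr_le0 ?ltW.
  move=> /ray_scale/(_ hd); rewrite -rmorphM/= divfK//.
  by rewrite lt_eqF.
move=> [x y].
pose t := y / (kappa - 2); pose s := t < 0.
have := ray_add (ray_scale (normr_ge0 t) (direction_imaginary chi s))
  (real (x - `|t| * (1 + 2 * kappa))).
congr (direction (ray _ chi)); apply/eqP; rewrite eq_complex /=; apply/andP; split; apply/eqP.
  by rewrite mul0r subr0 addrC subrK.
rewrite mul0r !addr0 mulrA [`|t| * _]mulrC -realEsign ?num_real// /t divfK//.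
by rewrite subr_eq0.
Qed.

(** For a generator r the combination r(w) r(y) itself absorbs -(r(w) r(y) - 1), as
their sum is the constant kernel 1. *)
Lemma free_gen k : free (gen k).
Proof.
apply: (@free_of_negative _ (-1)); first by rewrite oppr_lt0.
exists (point k); split; first by move=> i; rewrite /point ler0n.
rewrite sum_point.
have h1 : factorable 1 (fun w y : T => (1 : C) * 1).
  by apply: factorable_rank1 => w; exact: normc1.
apply: factorable_ext h1 => w y.
by rewrite combination_point /ray rmorphN/= mulN1r opprB mulr1 subrKC.
Qed.

(** Take f with values 2, b, b, 0 on the four classes of the pair of characters. Its
coefficient at the product character has the sign of 1 - b, and that of its dual
function the sign of 2^(p-2) - b^(p-1). These are opposite when b lies strictly
between 1 and 2^((p-2)/(p-1)), an interval that is nonempty exactly for p <> 2; the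
chosen [b] is the geometric mean of its end points. The components along the two
given characters are removed because these are free. *)
Lemma free_addb chi chi' : free chi -> free chi' ->
  free (fun w => chi w (+) chi' w).
Proof.
move=> h h'.
pose beta : R := 2 `^ ((p - 2) / 2).
pose b : R := beta `^ (p - 1)^-1.
pose f (s t : bool) : C := if s (+) t then (b%:C)%C else if s then 0 else 2.
have p10 : 0 < p - 1 by rewrite subr_gt0.
have b0 : 0 <= b by exact: powR_ge0.
have beta0 : 0 < beta by exact: powR_gt0.
have bpow : b `^ (p - 1) = beta by rewrite powR_invK ?gt_eqF// ltW.
have kE : kappa = 2 * beta ^+ 2.
  rewrite /kappa /beta -powR_mulrn ?powR_ge0// -powRrM divfK// -[X in X * _]powRr1//.
  by rewrite -powRD ?pnatr_eq0 ?implybT//; congr (_ `^ _); ring.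
have betaN1 : beta != 1.
  apply: contra kappaN2 => /eqP beta1.
  by rewrite kE beta1 expr1n mulr1.
have d0 : beta * (1 - b) * (beta - 1) < 0.
  rewrite -mulrA pmulr_rlt0//; move: betaN1; rewrite neq_lt => /orP[bl|bg].
    have b1 : b < 1.
      by rewrite -(one_powR (p - 1)^-1) gt0_ltr_powR ?invr_gt0// nnegrE// ltW.
    by rewrite pmulr_rlt0 ?subr_gt0// subr_lt0.
  have b1 : 1 < b.
    by rewrite -(one_powR (p - 1)^-1) gt0_ltr_powR ?invr_gt0// nnegrE// ltW.
  by rewrite nmulr_rlt0 ?subr_lt0// subr_gt0.
apply: (free_of_negative d0).
have := direction_pair chi chi' f; rewrite /=.
set g := fun s t : bool => _.
set z1 := (X in ray X chi); set z2 := (X in ray X chi'); set z3 := (X in ray X (fun w => chi w (+) chi' w)).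
have -> : z3 = ((beta * (1 - b) * (beta - 1))%:C)%C.
  have gE : g = fun s t : bool => if s (+) t then (beta%:C)%C
                                   else if s then 0 else (kappa%:C)%C.
    apply/funext => s; apply/funext => t; rewrite /g /f.
    case: (s (+) t); first by rewrite dual_value_real// bpow.
    case: s; first exact: dual_value0.
    by rewrite -(dual_value_real (ler0n R 2)) rmorph_nat.
  rewrite /z3 gE fourier_diagonal kE.
  have -> : beta * (1 - b) * (beta - 1) = 4^-1 * (2 - 2 * b) * (2 * beta ^+ 2 - 2 * beta).
    by field.
  by rewrite !(rmorphM, rmorphB, fmorphV, rmorphXn, rmorph_nat).
move=> H; have := direction_add H (direction_add (h (- z1)) (h' (- z2))).
by apply: direction_ext => w y; rewrite /ray !mulNr -opprD addrAC subrr add0r.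
Qed.

End SignKernels.

(** * An interior kernel on the cube *)

Section Rearrangements.
Variable K : numFieldType.

Lemma four_directions (c1 c2 c3 c4 xp xm yp ym i v : K) :
  c1 + xp * (1 * v) + (c2 + xm * (-1 * v)) +
  (c3 + yp * (i * v) + (c4 + ym * (- i * v))) =
  c1 + c2 + (c3 + c4) + (xp - xm + (yp - ym) * i) * v.
Proof. by ring. Qed.

Lemma recenter (s z c d : K) : s != 0 ->
  s^-1 * (c + (s * z * (d - 1) - z * (c + 1 - s)) + 1) =
  (1 - z) * (s^-1 * (c + 1)) + z * d.
Proof. by move=> s0; field. Qed.

End Rearrangements.

Section Uniform.
Variables (R : realType) (p q : R).
Hypotheses (p1 : 1 < p) (q1 : 1 < q) (pq : p^-1 + q^-1 = 1).
Local Notation C := R[i].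
Let p0 : 0 < p. Proof. exact: lt_trans p1. Qed.
Let q0 : 0 < q. Proof. exact: lt_trans q1. Qed.
Variables (T : finType) (n : nat) (gen : 'I_n.+1 -> T -> bool).
Local Notation factorable := (factorable p q).
Local Notation combination := (combination gen).
Local Notation direction := (direction p q gen).

Lemma factorable_combination (c : 'I_n.+1 -> R) : (forall k, 0 <= c k) ->
  factorable (\sum_k c k) (combination c).
Proof.
move=> c0; apply: factorable_sum => // k.
rewrite -[c k]mulr1; have h := factorable_sign p q (gen k).
by rewrite mulr1; have := factorable_scale p0 q0 pq (c0 k) h; rewrite mulr1.
Qed.

(** Convexity between [V] and the zero direction. *)
Lemma direction_shrink (V : T -> T -> C) (c : 'I_n.+1 -> R) (t : R) :
  (forall k, 0 <= c k) -> 0 <= t <= 1 ->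
  factorable (\sum_k c k) (fun w y => combination c w y + V w y) ->
  factorable (\sum_k c k) (fun w y => combination c w y + (t%:C)%C * V w y).
Proof.
move=> c0 /andP[t0 t1] h.
have t1' : 0 <= 1 - t by rewrite subr_ge0.
have := factorable_add (factorable_scale p0 q0 pq t0 h)
  (factorable_scale p0 q0 pq t1' (factorable_combination c0)).
rewrite -mulrDl subrKC mul1r; apply: factorable_ext => w y.
by rewrite rmorphB/= rmorph1 mulrDr mulrBl mul1r addrAC subrKC.
Qed.

(** The four directions V, -V, iV, -iV span the unit disc with coefficients in
[0, 1]. *)
Lemma direction_disc (V : T -> T -> C) :
  (forall z, direction (fun w y => z * V w y)) ->
  exists c : 'I_n.+1 -> R, (forall k, 0 <= c k) /\ forall z, normc z <= 1 ->
    factorable (\sum_k c k) (fun w y => combination c w y + z * V w y).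
Proof.
move=> h.
have [c1 [p1' h1]] := h 1; have [c2 [p2' h2]] := h (-1).
have [c3 [p3' h3]] := h 'i%C; have [c4 [p4' h4]] := h (- 'i%C).
exists (fun k => c1 k + c2 k + (c3 k + c4 k)); split.
  by move=> k; rewrite !addr_ge0.
move=> z z1.
have [x [y [zE x1 y1]]] : exists x y : R, [/\ z = (x%:C)%C + (y%:C)%C * 'i%C, `|x| <= 1 & `|y| <= 1].
  case: z z1 => x y z1; exists x, y; split.
  - by apply/eqP; rewrite eq_complex /= !(mul0r, mulr0, mulr1, addr0, add0r, subr0) !eqxx.
  - apply: le_trans z1; rewrite /= -sqrtr_sqr ler_wsqrtr// lerDl sqr_ge0//.
  - apply: le_trans z1; rewrite /= -sqrtr_sqr ler_wsqrtr// lerDr sqr_ge0//.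
have pos (r : R) : `|r| <= 1 -> 0 <= Num.max r 0 <= 1 /\ 0 <= Num.max (- r) 0 <= 1.
  rewrite ler_norml => /andP[r1 r2]; rewrite !le_max !ge_max !lexx !orbT ler01 !andbT r2.
  by split=> //; rewrite lerNl.
have parts (r : R) : (r%:C)%C = ((Num.max r 0)%:C)%C - ((Num.max (- r) 0)%:C)%C :> C.
  rewrite -rmorphB/=; congr (_%:C)%C; have /orP[r0|r0] := le_total 0 r.
    by rewrite max_l// max_r ?oppr_le0// subr0.
  by rewrite max_r// max_l ?oppr_ge0// sub0r opprK.
have [[xa xb] [ya yb]] := (pos _ x1, pos _ y1).
have := factorable_add
  (factorable_add (direction_shrink p1' xa h1) (direction_shrink p2' xb h2))
  (factorable_add (direction_shrink p3' ya h3) (direction_shrink p4' yb h4)).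
rewrite -!big_split/=; apply: factorable_ext => w v.
by rewrite /= !combinationD four_directions -!parts -zE.
Qed.

Lemma direction_disc_family (I : finType) (V : I -> T -> T -> C) :
  (forall i z, direction (fun w y => z * V i w y)) ->
  exists c : 'I_n.+1 -> R, (forall k, 0 <= c k) /\
    forall z : I -> C, (forall i, normc (z i) <= 1) ->
    factorable (\sum_k c k) (fun w y => combination c w y + \sum_i z i * V i w y).
Proof.
move=> /(_ _)/direction_disc => h; have [c cP] := choice h.
exists (fun k => \sum_i c i k); split.
  by move=> k; apply: sumr_ge0 => i _; have [c0 _] := cP i.
move=> z z1; rewrite exchange_big/=.
have : forall i, factorable (\sum_k c i k) (fun w y => combination (c i) w y + z i * V i w y).
  by move=> i; have [_] := cP i; apply.
move=> /(factorable_sum p0 q0 pq); apply: factorable_ext => w y.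
rewrite big_split/=; congr (_ + _); rewrite exchange_big/=.
by apply: eq_bigr => k _; rewrite rmorph_sum/= mulr_suml.
Qed.

End Uniform.

Section Cube.
Variables (R : realType) (p q : R).
Hypotheses (p1 : 1 < p) (q1 : 1 < q) (pq : p^-1 + q^-1 = 1) (p2 : p != 2).
Local Notation C := R[i].
Let p0 : 0 < p. Proof. exact: lt_trans p1. Qed.
Let q0 : 0 < q. Proof. exact: lt_trans q1. Qed.
Variable l : nat.
Local Notation T := {ffun 'I_l -> bool}.

(** Index 0 is the constant character, the other indices are the coordinates. *)
Definition rademacher (k : 'I_l.+1) (w : T) : bool :=
  if unlift ord0 k is Some j then w j else false.

Lemma rademacher0 w : rademacher ord0 w = false.
Proof. by rewrite /rademacher unlift_none. Qed.

Definition walsh (S : {set 'I_l}) (w : T) : bool := \big[addb/false]_(j in S) w j.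

Local Notation free := (free p q rademacher).

Lemma free_walsh S : free (walsh S).
Proof.
have -> : walsh S = fun w : T => \big[addb/false]_(j <- enum S) w j.
  by apply/funext => w; rewrite /walsh big_enum.
elim: (enum S) => [|j s IH].
  have -> : (fun w : T => \big[addb/false]_(j <- [::]) w j) = rademacher ord0.
    by apply/funext => w; rewrite big_nil rademacher0.
  exact: (free_gen p1 q1 pq rademacher0 p2).
have -> : (fun w : T => \big[addb/false]_(i <- j :: s) w i) =
    (fun w : T => rademacher (lift ord0 j) w (+) \big[addb/false]_(i <- s) w i).
  by apply/funext => w; rewrite big_cons /rademacher liftK.
by apply: (free_addb p1 q1 pq rademacher0 p2) => //; exact: (free_gen p1 q1 pq rademacher0 p2).
Qed.

(** Orthogonality of the characters of the cube, from the expansion of the product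
of the factors 1 + w_j y_j. *)
Lemma sum_walsh (w y : T) :
  \sum_(S : {set 'I_l}) sign_kernel R (walsh S) w y = (2 ^+ l : C) * id_kernel R w y.
Proof.
transitivity (\prod_(j < l) (sgn R (w j) * sgn R (y j) + 1)).
  rewrite bigA_distr; apply: eq_bigr => S _.
  rewrite /sign_kernel /walsh !(big_morph (sgn R) (@sgn_addb R) (erefl : sgn R false = 1)).
  by rewrite -big_split/= big_mkcond.
rewrite /id_kernel; case: eqVneq => [<-|wy].
  rewrite mulr1; under eq_bigr do rewrite /sgn -expr2 sqrr_sign.
  by rewrite prodr_const card_ord.
have [j wyj] : exists j, w j != y j.
  by apply/existsP; apply: contraNT wy => /existsPn h; apply/eqP/ffunP => j; apply/eqP; have := h j; rewrite negbK.
rewrite mulr0; apply/eqP/prodf_eq0; exists j => //.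
by move: wyj; rewrite /sgn; case: (w j); case: (y j) => //= _; rewrite ?expr0 ?expr1 ?mulr1 ?mul1r addNr.
Qed.

Lemma direction_id z :
  direction p q rademacher (fun w y => z * (id_kernel R w y - 1)).
Proof.
have dS S : direction p q rademacher (ray (z / 2 ^+ l) (walsh S)) by exact: free_walsh.
have : direction p q rademacher (fun w y => \sum_S ray (z / 2 ^+ l) (walsh S) w y).
  elim: (index_enum _) => [|S s IH].
    apply: direction_ext (direction0 p1 q1 pq rademacher) => w y.
    by rewrite big_nil.
  apply: direction_ext (direction_add (dS S) IH) => w y.
  by rewrite big_cons.
apply: direction_ext => w y; rewrite /ray -mulr_sumr sumrB sum_walsh sumr_const.
have -> : #|[pred _ : {set 'I_l} | true]| = (2 ^ l)%N.
  have -> : #|[pred _ : {set 'I_l} | true]| = #|powerset [set: 'I_l]|.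
    by apply: eq_card => S; rewrite powersetE finset.subsetT.
  by rewrite card_powerset cardsT card_ord.
have N0 : (2 : C) ^+ l != 0 by rewrite expf_neq0// pnatr_eq0.
by rewrite natrX -[X in _ - X]mulr1 -mulrBr mulrA divfK.
Qed.

(** Id - 1 and all r_k r_k - 1 are absorbed simultaneously for all coefficients in
the unit disc. With coefficient s z for the first and - c_k z for the others the
sum is s times (1 - z) Phi + z Id, where Phi is the combination with weights
c_k / s. Adding the constant kernel makes s positive. *)
Lemma interior_kernel : exists (c : 'I_l.+1 -> R) (J : nat),
  [/\ (0 < J)%N, forall k, 0 <= c k, \sum_k c k = 1 &
   forall z : C, normc z <= J%:R^-1 ->
     factorable p q 1 (fun w y =>
       (1 - z) * combination rademacher c w y + z * id_kernel R w y)].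
Proof.
pose V (i : unit + 'I_l.+1) (w y : T) : C :=
  if i is inr k then sign_kernel R (rademacher k) w y - 1 else id_kernel R w y - 1.
have [|c0 [c00 h]] := @direction_disc_family R p q p1 q1 pq T l rademacher _ V.
  by case=> [u|k] z; [exact: direction_id|exact: (free_gen p1 q1 pq rademacher0 p2)].
pose c1 k := c0 k + point R ord0 k.
have c10 k : 0 <= c1 k by rewrite addr_ge0// /point ler0n.
pose s := \sum_k c1 k.
have s1 : 1 <= s.
  by rewrite /s big_split/= sum_point lerDr sumr_ge0.
have s0 : 0 < s := lt_le_trans ltr01 s1.
have sC : (s%:C)%C != 0 :> C.
  by apply/eqP => /(congr1 (@normc R)); rewrite normc_real normc0 gtr0_norm// => /eqP; rewrite gt_eqF.
have c1s k : c1 k <= s by rewrite /s (bigD1 k)//= lerDl sumr_ge0.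
have combS : combination rademacher c1 = fun w y : T =>
    combination rademacher c0 w y + 1.
  by apply/funext => w; apply/funext => y; rewrite combinationD combination_point0// => ?; exact: rademacher0.
exists (fun k => c1 k / s), (Num.truncn s).+1; split=> // [k||z zJ].
- by rewrite divr_ge0// ltW.
- by rewrite -mulr_suml divff// gt_eqF.
have zs : normc z * s <= 1.
  have sJ : s <= (Num.truncn s).+1%:R by rewrite ltW// truncnS_gt.
  apply: le_trans (ler_pM (normc_ge0 z) (ltW s0) zJ sJ) _.
  by rewrite mulVf// pnatr_eq0.
pose zeta (i : unit + 'I_l.+1) : C :=
  if i is inr k then - (((c1 k)%:C)%C * z) else (s%:C)%C * z.
have zeta1 i : normc (zeta i) <= 1.
  case: i => [u|k] /=; first by rewrite normcM normc_real gtr0_norm// mulrC.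
  rewrite normcN normcM normc_real ger0_norm// mulrC.
  by apply: le_trans zs; rewrite ler_wpM2l// normc_ge0.
have one : factorable p q 1 (fun w y : T => (1 : C)).
  have := @factorable_rank1 R p q T (fun=> 1) (fun=> normc1 R).
  by apply: factorable_ext => w y; rewrite mulr1.
have := factorable_add (h _ zeta1) one.
have -> : \sum_k c0 k + 1 = s by rewrite /s big_split/= sum_point.
have si0 : 0 <= s^-1 by rewrite invr_ge0 ltW.
move=> /(factorable_scale p0 q0 pq si0); rewrite mulVf ?gt_eqF//.
apply: factorable_ext => w y; rewrite big_sumType/= big_const card_unit/= addr0.
have -> : \sum_k - (((c1 k)%:C)%C * z) * (sign_kernel R (rademacher k) w y - 1) =
    - z * (combination rademacher c0 w y + 1 - (s%:C)%C).
  transitivity (- z * (combination rademacher c1 w y - (s%:C)%C)); last by rewrite combS.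
  rewrite /combination rmorph_sum/= -sumrB mulr_sumr; apply: eq_bigr => k _.
  by rewrite [_ * z]mulrC -mulNr -mulrA mulrBr mulr1.
have -> : combination rademacher (fun k => c1 k / s) w y =
    (s%:C)%C^-1 * (combination rademacher c0 w y + 1).
  rewrite -fmorphV -[X in _ * X]/((fun w y : T => combination rademacher c0 w y + 1) w y) -combS.
  by rewrite -combinationZ; apply: eq_bigr => k _; congr (_%:C%C * _); exact: mulrC.
by rewrite mulNr fmorphV recenter.
Qed.

End Cube.

(** * Few vectors against tensor powers *)

Lemma segment_recenter (K : numFieldType) (a x z P D : K) : a != 0 -> a = 1 - x ->
  a * ((1 - (z - x) / a) * P + (z - x) / a * D) + x * D = (1 - z) * P + z * D.
Proof.
move=> a0 ax; have -> : x = 1 - a by rewrite ax; ring.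
by field.
Qed.

Lemma sum_exprn_card (K : numFieldType) t (a : K) :
  \sum_(S : {set 'I_t}) a ^+ #|S| = (1 + a) ^+ t.
Proof.
rewrite -[X in _ ^+ X](card_ord t) -prodr_const; under [RHS]eq_bigr do rewrite addrC.
rewrite bigA_distr; apply: eq_bigr => S _.
by rewrite -prodr_const big_mkcond.
Qed.

Section FewVectors.
Variables (R : realType) (p q : R).
Hypotheses (p1 : 1 < p) (q1 : 1 < q) (pq : p^-1 + q^-1 = 1).
Local Notation C := R[i].
Let p0 : 0 < p. Proof. exact: lt_trans p1. Qed.
Let q0 : 0 < q. Proof. exact: lt_trans q1. Qed.
Variable T : finType.
Local Notation N := (#|T|%:R : R).
Variables (Phi : T -> T -> C) (J : nat).
Hypotheses (J0 : (0 < J)%N) (T0 : (0 < #|T|)%N)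
  (Phi1 : forall w y, normc (Phi w y) <= 1)
  (PhiJ : forall z : C, normc z <= J%:R^-1 ->
     factorable p q 1 (fun w y => (1 - z) * Phi w y + z * id_kernel R w y)).

Definition segment (z : C) (w y : T) : C := (1 - z) * Phi w y + z * id_kernel R w y.

(** The points of a neighbourhood of [0, 1/2] are convex combinations of 1, where the
kernel is Id, and of a point of the disc of radius 1/J: a perturbation of x by w
is x * 1 + (1 - x) * (w / (1 - x)) with 1 - x >= 1/2. *)
Lemma factorable_segment (x : R) z : 0 <= x <= 1 / 2 ->
  normc (z - (x%:C)%C) <= 4 / (8 * J)%:R ->
  factorable p q 1 (segment z).
Proof.
move=> /andP[x0 x12] zx.
have x1 : 0 < 1 - x by lra.
have x1C : ((1 - x)%:C)%C != 0 :> C.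
  by apply/eqP => /(congr1 (@normc R)); rewrite normc_real normc0 gtr0_norm// => /eqP; rewrite gt_eqF.
pose z' := (z - (x%:C)%C) / ((1 - x)%:C)%C.
have JR : 0 < J%:R :> R by rewrite ltr0n.
have z'J : normc z' <= J%:R^-1.
  rewrite normcM normcV normc_real gtr0_norm// ler_pdivrMr//.
  apply: le_trans zx _; rewrite natrM invfM mulrA [leRHS]mulrC ler_wpM2r ?invr_ge0//; lra.
have := factorable_add (factorable_scale p0 q0 pq (ltW x1) (PhiJ z'J))
   (factorable_scale p0 q0 pq x0 (factorable_id p0 q0 T)).
rewrite !mulr1 subrK; apply: factorable_ext => w y; rewrite /segment.
by rewrite segment_recenter// rmorphB rmorph1.
Qed.

Variables (t m : nat).
Local Notation Tt := {ffun 'I_t -> T}.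

(** The terms of the expansion of the tensor power of [segment z]. *)
Definition mixed (S : {set 'I_t}) (w y : Tt) : C :=
  \prod_j (if j \in S then id_kernel R (w j) (y j) else Phi (w j) (y j)).

Lemma factorable_Phi : factorable p q 1 Phi.
Proof.
have := PhiJ (z := 0); rewrite normc0 invr_ge0 ler0n => /(_ isT).
by apply: factorable_ext => w y; rewrite subr0 mul1r mul0r addr0.
Qed.

Lemma factorable_mixed S : factorable p q 1 (mixed S).
Proof.
pose P (b : bool) := if b then @id_kernel R T else Phi.
have hP b : factorable p q 1 (P b).
  by case: b; [exact: factorable_id|exact: factorable_Phi].
apply: factorable_ext (factorable_tensor p0 q0 S hP) => w y.
by apply: eq_bigr => j _; rewrite /P; case: ifP.
Qed.

Lemma segment_tensor z (w y : Tt) : \prod_j segment z (w j) (y j) =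
  \sum_(S : {set 'I_t}) z ^+ #|S| * (1 - z) ^+ (t - #|S|) * mixed S w y.
Proof.
rewrite /segment; under eq_bigr do rewrite addrC.
rewrite bigA_distr; apply: eq_bigr => S _.
have -> : (t - #|S|)%N = #|~: S| by rewrite [RHS]cardsCs finset.setCK card_ord.
rewrite -!prodr_const [X in X * _ * _]big_mkcond [X in _ * X * _]big_mkcond/=.
rewrite -!big_split/=; apply: eq_bigr => j _; rewrite !inE.
by case: ifP => _ /=; rewrite ?mulr1 ?mul1r.
Qed.

Variables (x : 'I_m -> Tt -> C) (W V : R) (v : 'I_m -> C) (w : 'I_m -> Tt).
Hypotheses (W0 : 0 <= W) (V0 : 0 <= V)
  (xW : forall g : Tt -> C, \sum_i normc (\sum_y g y * x i y) `^ p <=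
     W `^ p * \sum_y normc (g y) `^ p)
  (vV : \sum_i normc (v i) `^ q <= V `^ q).

(** The linear functional on kernels given by the vectors [x], the rows [w] at which
the images are evaluated and the dual coefficients [v]. *)
Definition tested (K : Tt -> Tt -> C) : C :=
  \sum_i v i * \sum_y K (w i) y * x i y.

Let bound : R := V * (W * (N ^+ t) `^ p^-1).

Lemma bound_ge0 : 0 <= bound.
Proof. by rewrite !mulr_ge0// powR_ge0. Qed.

Lemma tested_le K : factorable p q 1 K -> normc (tested K) <= bound.
Proof.
move=> fK; have := factorable_pairing p0 q0 pq w fK W0 V0 xW vV.
by rewrite card_ffun card_ord natrX.
Qed.

Lemma v_le i : normc (v i) <= V.
Proof.
apply: (ler_of_powR q0 (normc_ge0 _) V0); apply: le_trans vV.
by rewrite (bigD1 i)//= lerDl; apply: sumr_ge0 => k _; exact: powR_ge0.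
Qed.

Lemma mixed_row S (u : Tt) : \sum_y normc (mixed S u y) `^ p <= N ^+ (t - #|S|).
Proof.
under eq_bigr do rewrite normc_prod_powR.
rewrite -(bigA_distr_bigA (fun j y => normc (if j \in S then id_kernel R (u j) y else Phi (u j) y) `^ p)).
have -> : (t - #|S|)%N = #|~: S| by rewrite [RHS]cardsCs finset.setCK card_ord.
rewrite -prodr_const [leRHS]big_mkcond/=; apply: ler_prod => j _.
rewrite sum_powR_ge0/= inE; case: (boolP (j \in S)) => _ /=.
  rewrite (bigD1 (u j))//= /id_kernel eqxx normc1 one_powR big1 ?addr0// => y yu.
  by rewrite eq_sym (negPf yu) normc_powR0.
rewrite -sum1_card natr_sum; apply: ler_sum => y _.
by rewrite -[leRHS](one_powR p) ge0_ler_powR ?nnegrE ?normc_ge0// ltW.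
Qed.

Let theta0 : R := N `^ (- p^-1).

Lemma theta0_gt0 : 0 < theta0. Proof. by rewrite powR_gt0// ltr0n. Qed.

(** A row of [mixed S] has p-th power sum at most N^(t - |S|); the m vectors are
estimated one by one. *)
Lemma tested_mixed_small S : normc (tested (mixed S)) <= bound * (m%:R * theta0 ^+ #|S|).
Proof.
have row i : normc (\sum_y mixed S (w i) y * x i y) <= W * (N ^+ (t - #|S|)) `^ p^-1.
  have P0 : 0 <= N ^+ (t - #|S|) by rewrite exprn_ge0.
  apply: (ler_of_powR p0 (normc_ge0 _)); first by rewrite mulr_ge0 ?powR_ge0.
  rewrite powRM ?powR_ge0// powR_invK ?gt_eqF//.
  apply: le_trans (_ : W `^ p * \sum_y normc (mixed S (w i) y) `^ p <= _).
    apply: le_trans (xW _); rewrite [leRHS](bigD1 i)//= lerDl.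
    by apply: sumr_ge0 => k _; exact: powR_ge0.
  by rewrite ler_wpM2l ?powR_ge0// mixed_row.
apply: le_trans (normc_sum _ _ _) _.
apply: le_trans (_ : \sum_(i < m) V * (W * (N ^+ (t - #|S|)) `^ p^-1) <= _).
  by apply: ler_sum => i _; rewrite normcM ler_pM ?normc_ge0 ?v_le.
rewrite sumr_const card_ord -[leLHS]mulr_natl.
have N0 : 0 < N by rewrite ltr0n.
have St : (#|S| <= t)%N by rewrite -[t in leqRHS]card_ord max_card.
have -> : (N ^+ (t - #|S|)) `^ p^-1 = (N ^+ t) `^ p^-1 * theta0 ^+ #|S|.
  rewrite /theta0 -!powR_mulrn ?ltW ?powR_gt0// -!powRrM -powRD ?(gt_eqF N0) ?implybT//.
  by congr (_ `^ _); rewrite natrB//; ring.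
by rewrite /bound le_eqVlt; apply/orP; left; apply/eqP; ring.
Qed.

Lemma min_powR (y s : R) : 0 < y -> 0 <= s <= 1 -> forall a, a <= 1 -> a <= y -> a <= y `^ s.
Proof.
move=> y0 /andP[s0 s1] a a1 ay; have [y1|y1] := leP y 1.
  by apply: le_trans ay _; rewrite ger1_powR// y0.
apply: le_trans a1 _; rewrite -[leLHS](one_powR s) ge0_ler_powR ?nnegrE// ltW//.
Qed.

(** Geometric interpolation, with exponent s, between the bound of [tested_le] and
the one of [tested_mixed_small]. It costs the number of vectors only to the power
s. *)
Lemma tested_mixed_interpolated S (s : R) : (0 < m)%N -> 0 <= s <= 1 ->
  normc (tested (mixed S)) <= bound * (m%:R `^ s * (theta0 `^ s) ^+ #|S|).
Proof.
move=> m0 s01; have [b0|bN0] := eqVneq bound 0.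
  by have := tested_le (factorable_mixed S); rewrite b0 mul0r.
have b0 : 0 < bound by rewrite lt_def bN0 bound_ge0.
have th0 := theta0_gt0.
rewrite mulrC -ler_pdivrMr//.
have -> : m%:R `^ s * (theta0 `^ s) ^+ #|S| = (m%:R * theta0 ^+ #|S|) `^ s.
  by rewrite powRM ?exprn_ge0 ?(ltW th0)// exprn_powR ?(ltW th0).
apply: min_powR => //.
- by rewrite mulr_gt0 ?exprn_gt0// ltr0n.
- by rewrite ler_pdivrMr// mul1r; exact: tested_le (factorable_mixed S).
- by rewrite ler_pdivrMr// mulrC; exact: tested_mixed_small.
Qed.

Definition tested_poly : {poly C} :=
  \sum_(S : {set 'I_t}) (tested (mixed S))%:P * ('X ^+ #|S| * (1 - 'X) ^+ (t - #|S|)).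

Lemma horner_tested_poly z :
  tested_poly.[z] = tested (fun w y => \prod_j segment z (w j) (y j)).
Proof.
rewrite /tested_poly horner_sum /tested.
under [RHS]eq_bigr do under eq_bigr do rewrite segment_tensor mulr_suml.
under [RHS]eq_bigr do rewrite exchange_big/= mulr_sumr.
rewrite exchange_big/=; apply: eq_bigr => S _.
rewrite hornerM hornerC.
have -> : ('X^#|S| * (1 - 'X) ^+ (t - #|S|)).[z] = z ^+ #|S| * (1 - z) ^+ (t - #|S|).
  by rewrite !hornerE.
rewrite mulr_suml; apply: eq_bigr => i _.
rewrite -mulrA [_ * (z ^+ _ * _)]mulrC mulr_sumr; congr (_ * _).
by apply: eq_bigr => y _; rewrite !mulrA.
Qed.

(** Near 1/2 both z and 1 - z have modulus at most 3/5, so the expansion over the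
sets S sums to the t-th power in the hypothesis. The polynomial is bounded near
[0, 1/2] by [factorable_segment], and [propagation] applies. *)
Lemma tested_small (s eta : R) : (0 < m)%N -> 0 <= s <= 1 -> 0 <= eta -> (1 < J)%N ->
  m%:R `^ s * (3 / 5 * (1 + theta0 `^ s)) ^+ t <= iter (8 * J) (@shrink R) eta ->
  normc (tested (fun w y => \prod_j Phi (w j) (y j))) <= bound * eta.
Proof.
move=> m0 s01 eta0 J1 small.
have [b0|bN0] := eqVneq bound 0.
  have := tested_le (factorable_mixed finset.set0); rewrite b0 mul0r.
  have -> // : mixed finset.set0 = (fun w y => \prod_j Phi (w j) (y j)).
  by apply/funext => a; apply/funext => b; apply: eq_bigr => j _; rewrite finset.in_set0.
have b0 : 0 < bound by rewrite lt_def bN0 bound_ge0.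
have bi0 : 0 <= bound^-1 by rewrite invr_ge0 ltW.
have -> : (fun w y : Tt => \prod_j Phi (w j) (y j)) = (fun w y : Tt => \prod_j segment 0 (w j) (y j)).
  apply/funext => a; apply/funext => b; apply: eq_bigr => j _.
  by rewrite /segment subr0 mul1r mul0r addr0.
rewrite -horner_tested_poly.
pose f := (bound^-1%:C)%C *: tested_poly.
have fE z : normc f.[z] = bound^-1 * normc tested_poly.[z].
  by rewrite hornerZ normcM normc_real ger0_norm.
suff : normc f.[0] <= eta by rewrite fE ler_pdivrMl.
apply: (@propagation _ (8 * J)) => //; first by rewrite muln_gt0.
- move=> y z y01 zy; rewrite fE ler_pdivrMl// mulr1 horner_tested_poly; apply: tested_le.
  have fs := factorable_segment y01 zy.
  exact: factorable_ext (factorable_tensor p0 q0 finset.set0 (fun _ : bool => fs)).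
- move=> z z12; apply: le_trans small; rewrite fE ler_pdivrMl//.
  have z35 : normc z <= 3 / 5 /\ normc (1 - z) <= 3 / 5.
    have j8 : 1 / (8 * J)%:R <= 1 / 10 :> R.
      have : 16 <= (8 * J)%:R :> R by rewrite ler_nat (leq_trans _ (leq_mul (leqnn 8) J1)).
      move=> J16; rewrite ler_pdivrMr ?(lt_le_trans _ J16)//; lra.
    have h1 := le_normcD (z - ((1 / 2)%:C)%C) ((1 / 2)%:C)%C.
    have h2 := le_normcD (- (z - ((1 / 2)%:C)%C)) ((1 / 2)%:C)%C.
    have half : (1 - 1 / 2 : R) = 1 / 2 by field.
    have E : - (z - ((1 / 2)%:C)%C) + ((1 / 2)%:C)%C = 1 - z :> C.
      rewrite opprB addrAC -rmorphD/= (_ : 1 / 2 + 1 / 2 = 1 :> R) ?rmorph1//; by field.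
    have n2 : normc ((1 / 2)%:C)%C = 1 / 2 :> R by rewrite normc_real ger0_norm//; lra.
    move: h1 h2; rewrite subrK E normcN !n2; move: z12 j8 => /=.
    move: (normc (z - _)) (normc z) (normc (1 - z)) (1 / (8 * J)%:R) => n1 n3 n4 n5 *; split; lra.
  case: z35 => za zb.
  rewrite /tested_poly horner_sum; apply: le_trans (normc_sum _ _ _) _.
  apply: le_trans (_ : \sum_(S : {set 'I_t}) bound * (m%:R `^ s * (theta0 `^ s) ^+ #|S|) * (3 / 5) ^+ t <= _).
    apply: ler_sum => S _; rewrite hornerM hornerC normcM.
    have -> : ('X^#|S| * (1 - 'X) ^+ (t - #|S|)).[z] = z ^+ #|S| * (1 - z) ^+ (t - #|S|).
      by rewrite !hornerE.
    apply: ler_pM; rewrite ?normc_ge0//; first exact: tested_mixed_interpolated.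
    have St : (#|S| <= t)%N by rewrite -[t in leqRHS]card_ord max_card.
    rewrite normcM !normcX -[t in leRHS](subnKC St) exprD.
    by apply: ler_pM; rewrite ?exprn_ge0 ?normc_ge0//; apply: lerXn2r; rewrite ?nnegrE ?normc_ge0.
  rewrite -mulr_suml -!mulr_sumr sum_exprn_card -[leLHS]mulrA ler_wpM2l ?bound_ge0//.
  by rewrite -[leLHS]mulrA ler_wpM2l ?powR_ge0// [leRHS]exprMn mulrC.
Qed.

End FewVectors.

(** * From complex to real scalars *)

Lemma sup_norm_attained (R : realType) (T : finType) (a : T -> R) :
  (0 < #|T|)%N -> (forall t, 0 <= a t) -> exists t, sup_norm a = a t.
Proof.
move=> /card_gt0P[t0 _] a0.
pose t := [arg max_(t > t0) a t]%O; exists t.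
apply/eqP; rewrite eq_le sup_norm_coord andbT; apply: sup_norm_le => // u.
by rewrite /t; case: arg_maxP => // v _ h; exact: h.
Qed.

Section ComplexBound.
Variables (R : realType) (p q : R).
Hypotheses (p1 : 1 < p) (q1 : 1 < q) (pq : p^-1 + q^-1 = 1).
Local Notation C := R[i].
Let p0 : 0 < p. Proof. exact: lt_trans p1. Qed.
Let q0 : 0 < q. Proof. exact: lt_trans q1. Qed.
Variable T : finType.
Local Notation N := (#|T|%:R : R).
Variables (Phi : T -> T -> C) (J : nat).
Hypotheses (J1 : (1 < J)%N) (T0 : (0 < #|T|)%N)
  (Phi1 : forall w y, normc (Phi w y) <= 1)
  (PhiJ : forall z : C, normc z <= J%:R^-1 ->
     factorable p q 1 (fun w y => (1 - z) * Phi w y + z * id_kernel R w y)).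

(** Evaluate each image at a point where its sup norm is attained, and choose [v]
dual to the values obtained: the tested quantity is then the p-th power sum S^p,
while the bound contains S^(p-1). *)
Lemma few_vectors_bound (t m : nat) (W s eta : R) (x : 'I_m -> {ffun 'I_t -> T} -> C) :
  (0 < m)%N -> 0 <= W -> 0 <= s <= 1 -> 0 <= eta ->
  (forall g, \sum_i normc (\sum_y g y * x i y) `^ p <= W `^ p * \sum_y normc (g y) `^ p) ->
  m%:R `^ s * (3 / 5 * (1 + (N `^ (- p^-1)) `^ s)) ^+ t <= iter (8 * J) (@shrink R) eta ->
  \sum_i sup_norm (fun w : {ffun 'I_t -> T} =>
      normc (\sum_(y : {ffun 'I_t -> T}) (\prod_j Phi (w j) (y j)) * x i y)) `^ p
    <= (eta * (N ^+ t) `^ p^-1 * W) `^ p.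
Proof.
move=> m0 W0 s01 eta0 xW small.
pose K (w y : {ffun 'I_t -> T}) := \prod_j Phi (w j) (y j).
have Tt0 : (0 < #|{ffun 'I_t -> T}|)%N by rewrite card_ffun expn_gt0 T0.
have /choice[w wE] : forall i, exists w, sup_norm (fun w => normc (\sum_y K w y * x i y)) =
    normc (\sum_y K w y * x i y).
  by move=> i; apply: sup_norm_attained => // ?; exact: normc_ge0.
under eq_bigr do rewrite wE.
pose a i := \sum_y K (w i) y * x i y.
pose S := lq_norm p (fun i => normc (a i)).
have S0 : 0 <= S by exact: lq_norm_ge0.
have SE : \sum_i normc (a i) `^ p = S `^ p by rewrite lq_normE// gt_eqF.
rewrite -/(a _) SE.
apply: ge0_ler_powR; rewrite ?nnegrE ?mulr_ge0 ?powR_ge0 ?(ltW p0)//.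
pose v i := dual_value p (a i).
have vS : \sum_i normc (v i) `^ q <= (S `^ (p - 1)) `^ q.
  under eq_bigr do rewrite (normc_dual_value p1 q1 pq).
  by rewrite -powRrM (conjugate_exponent p1 q1 pq) SE.
have J0 : (0 < J)%N by exact: ltn_trans J1.
have := tested_small p1 q1 pq J0 T0 Phi1 PhiJ w W0 (powR_ge0 S (p - 1)) xW vS m0 s01 eta0 J1 small.
have -> : tested x v w (fun w y => \prod_j Phi (w j) (y j)) = ((S `^ p)%:C)%C.
  rewrite -SE rmorph_sum/=; apply: eq_bigr => i _.
  by rewrite -(dual_valueM p1) mulrC.
rewrite normc_real ger0_norm ?powR_ge0//.
have [->|SN0] := eqVneq S 0; first by rewrite !mulr_ge0// powR_ge0.
have {}S0 : 0 < S by rewrite lt_def SN0.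
move=> h; rewrite -(ler_pM2l (powR_gt0 (p - 1) S0)) [leLHS]mulrC mulr_powRB1 ?(ltW S0)//.
apply: le_trans h _; rewrite le_eqVlt; apply/orP; left; apply/eqP; ring.
Qed.

End ComplexBound.

Section Transfer.
Variables (R : realType) (F : scalars).
Local Notation K := (scalar_field R F).
Local Notation C := R[i].

(** The analytic argument needs complex scalars, also for real spaces. *)
Definition to_complex (a : K) : C :=
  match F return scalar_field R F -> R[i] with
  | RealScalars => fun a => (a%:C)%C
  | ComplexScalars => id
  end a.

Lemma to_complex_sum (T : finType) (M : T -> R) (x : T -> K) :
  modulus (\sum_y real_scalar F (M y) * x y) =
  normc (\sum_y ((M y)%:C)%C * to_complex (x y)).
Proof.
rewrite /to_complex /real_scalar /modulus; case: F x => /= x; last first.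
  by case: (\sum_y _).
rewrite -normc_real rmorph_sum/=; congr normc; apply: eq_bigr => y _.
by rewrite rmorphM.
Qed.

(** Real vectors are tested against the real and imaginary parts of a complex
coefficient vector, which costs a factor 2. *)
Lemma weakly_bounded_complex (p W : R) (T : finType) m (x : 'I_m -> T -> K) :
  1 < p -> 0 <= W -> weakly_bounded p W x ->
  forall g : T -> C, \sum_i normc (\sum_y g y * to_complex (x i y)) `^ p <=
    (2 * W) `^ p * \sum_y normc (g y) `^ p.
Proof.
move=> p1 W0 xW g; have p0 : 0 < p by exact: lt_trans p1.
move: x xW; rewrite /weakly_bounded /to_complex; case: F => x xW; last first.
  have normcE (z : C) : @modulus R ComplexScalars z = normc z by case: z.
  have := xW g; under eq_bigr => i _ do rewrite normcE.
  under [X in _ <= _ * X]eq_bigr => i _ do rewrite normcE.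
  move=> /le_trans; apply; rewrite ler_wpM2r//.
    by apply: sumr_ge0 => y _; exact: powR_ge0.
  by rewrite ge0_ler_powR ?nnegrE ?mulr_ge0 ?(ltW p0)//; lra.
pose A := lq_norm p (fun y => `|complex.Re (g y)|).
pose B := lq_norm p (fun y => `|complex.Im (g y)|).
pose G := lq_norm p (fun y => normc (g y)).
have AG : A <= G.
  apply: lq_norm_mono => // y; rewrite normr_ge0/=; case: (g y) => a b /=.
  by rewrite -sqrtr_sqr ler_wsqrtr// lerDl sqr_ge0.
have BG : B <= G.
  apply: lq_norm_mono => // y; rewrite normr_ge0/=; case: (g y) => a b /=.
  by rewrite -sqrtr_sqr ler_wsqrtr// lerDr sqr_ge0.
pose a i := `|\sum_y complex.Re (g y) * x i y|.
pose b i := `|\sum_y complex.Im (g y) * x i y|.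
have part (h : T -> R) : lq_norm p (fun i => `|\sum_y h y * x i y|) <= W * lq_norm p (fun y => `|h y|).
  rewrite lq_norm_le ?mulr_ge0 ?lq_norm_ge0// powRM ?lq_norm_ge0// lq_normE ?gt_eqF//.
  exact: (xW h).
have ab i : normc (\sum_y g y * ((x i y)%:C)%C) <= a i + b i.
  have -> : \sum_y g y * ((x i y)%:C)%C =
      ((\sum_y complex.Re (g y) * x i y) +i* (\sum_y complex.Im (g y) * x i y))%C.
    elim/big_rec3: _ => // y u v z _ ->; case: (g y) => c d; apply/eqP.
    by rewrite eq_complex /= !mulr0 subr0 add0r !eqxx.
  rewrite /a /b; move: (\sum_y _) (\sum_y _) => u v /=.
  rewrite -[leRHS]ger0_norm ?addr_ge0// -sqrtr_sqr ler_wsqrtr//.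
  by rewrite [leRHS]sqrrD !real_normK ?num_real// -addrA addrCA lerDr mulrn_wge0// mulr_ge0.
have G0 : 0 <= G by exact: lq_norm_ge0.
rewrite -[X in _ * X](lq_normE (fun y => normc (g y)) (lt0r_neq0 p0)) -/G -powRM ?mulr_ge0//.
rewrite -lq_norm_le ?mulr_ge0//.
apply: le_trans (lq_norm_mono p0 (b := fun i => a i + b i) _) _.
  by move=> i; rewrite normc_ge0 ab.
have pa : lq_norm p a <= W * A := part (fun y => complex.Re (g y)).
have pb : lq_norm p b <= W * B := part (fun y => complex.Im (g y)).
have a0 i : 0 <= a i by exact: normr_ge0.
have b0 i : 0 <= b i by exact: normr_ge0.
apply: le_trans (lq_normD p1 a0 b0) _.
apply: le_trans (lerD pa pb) _.
clearbody A B G; clear - W0 AG BG.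
have -> : 2 * W * G = W * (2 * G) by ring.
by rewrite -mulrDr ler_wpM2l//; lra.
Qed.

End Transfer.

(** * Choice of the dimensions *)

(** With l = j^2 and s = 4p/l the second quantity is 2^(-4), while the logarithm of
the first is at most K s ln (j^2 + 1) <= 8pK/j. *)
Lemma dimension_choice (R : realType) (p K : R) : 0 < p -> 0 <= K ->
  exists (l : nat) (s : R), [/\ (0 < l)%N, 0 <= s <= 1,
    (l.+1%:R `^ K) `^ s <= 11 / 10 & ((2 ^ l)%:R `^ (- p^-1)) `^ s <= 1 / 10].
Proof.
move=> p0 K0; pose L : R := ln (11 / 10).
have L0 : 0 < L by rewrite ln_gt0//; lra.
pose M : R := 8 * p * K / L + 4 * p.
pose j := (Num.truncn M).+1.
have jM : M <= j%:R by rewrite ltW// truncnS_gt.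
have q1 : 0 <= 8 * p * K / L by rewrite divr_ge0 ?(ltW L0)// !mulr_ge0 ?(ltW p0).
have j0 : 0 < j%:R :> R by rewrite ltr0n.
have j1 : 1 <= j%:R :> R by rewrite ler1n.
have jp : 4 * p <= j%:R by apply: le_trans jM; rewrite lerDr.
have jK : 8 * p * K / L <= j%:R by apply: le_trans jM; rewrite lerDl !mulr_ge0 ?(ltW p0).
have l0 : 0 < (j ^ 2)%:R :> R by rewrite ltr0n expn_gt0.
have lE : (j ^ 2)%:R = j%:R * j%:R :> R by rewrite natrX expr2.
exists (j ^ 2)%N, (4 * p / (j ^ 2)%:R); split.
- by rewrite expn_gt0.
- rewrite divr_ge0 ?mulr_ge0 ?(ltW p0)//= ler_pdivrMr// mul1r lE.
  by apply: le_trans jp _; rewrite ler_peMr// ltW.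
- have xN0 : (j ^ 2).+1%:R != 0 :> R by rewrite pnatr_eq0.
  rewrite -powRrM /powR (negPf xN0) -[leRHS](@lnK R) ?posrE; last by lra.
  rewrite ler_expR.
  have lnx : ln ((j ^ 2).+1%:R : R) <= 2 * j%:R.
    apply: le_trans (_ : ln (((1 + j%:R) ^+ 2) : R) <= _).
      rewrite ler_ln ?posrE ?ltr0n ?exprn_gt0 ?addr_gt0// -natr1 lE sqrrD expr1n mul1r.
      by rewrite -expr2 [in leLHS]addrC addrAC lerDl mulrn_wge0 ?(ltW j0).
    rewrite lnXn ?addr_gt0// -[_ *+ 2]mulr_natl ler_pM2l//.
    by apply: le_ln1Dx; lra.
  apply: le_trans (_ : K * (4 * p / (j ^ 2)%:R) * (2 * j%:R) <= _).
    by rewrite ler_wpM2l// mulr_ge0// divr_ge0 ?mulr_ge0 ?(ltW p0)// ltW.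
  have -> : K * (4 * p / (j ^ 2)%:R) * (2 * j%:R) = 8 * p * K / j%:R.
    by rewrite lE; field; rewrite gt_eqF.
  by rewrite ler_pdivrMr// [leRHS]mulrC -ler_pdivrMr.
- have -> : ((2 ^ (j ^ 2))%:R `^ (- p^-1)) `^ (4 * p / (j ^ 2)%:R) = 2 ^- 4 :> R.
    rewrite natrX -powR_mulrn// -!powRrM -powR_invn//; congr (_ `^ _).
    by field; rewrite !gt_eqF.
  by lra.
Qed.

Lemma geometric_small (R : realType) (a b d : R) : 0 <= a < 1 -> 0 < d ->
  exists t0, forall t, (t0 <= t)%N -> b * a ^+ t <= d.
Proof.
move=> /andP[a0 a1] d0.
have a1' : `|a| < 1 by rewrite ger0_norm.
have /cvgr0Pnorm_le/(_ _ d0)[t0 _ h] := cvg_geometric b a1'.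
exists t0 => t /h; rewrite /geometric/=; apply: le_trans; exact: ler_norm.
Qed.

(** Here [m] is the number of vectors and [X] the K-th power of l + 1; the factor lost
per tensor coordinate is 11/10 * 3/5 * 11/10 < 3/4. *)
Lemma polynomial_loses (R : realType) (A X m s theta : R) t :
  0 <= X -> 0 <= A -> 0 <= m -> 0 <= s -> 0 <= theta ->
  m <= A * X ^+ t.+1 -> X `^ s <= 11 / 10 -> theta <= 1 / 10 ->
  m `^ s * (3 / 5 * (1 + theta)) ^+ t <= A `^ s * (11 / 10) * (3 / 4) ^+ t.
Proof.
move=> X0 A0 m0 s0 th0 mA Xs th1.
have B0 : 0 <= 3 / 5 * (1 + theta) <= 33 / 50 by apply/andP; split; lra.
have [B00 B01] := andP B0.
have c1 : 0 <= 11 / 10 :> R by lra.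
have c2 : 0 <= 33 / 50 :> R by lra.
have c3 : 0 <= 11 / 10 * (33 / 50) :> R by lra.
have c4 : 0 <= 3 / 4 :> R by lra.
have c5 : 11 / 10 * (33 / 50) <= 3 / 4 :> R by lra.
have ms : m `^ s <= A `^ s * (11 / 10) ^+ t.+1.
  apply: le_trans (_ : (A * X ^+ t.+1) `^ s <= _).
    by rewrite ge0_ler_powR ?nnegrE ?mulr_ge0 ?exprn_ge0.
  rewrite powRM ?exprn_ge0// ler_wpM2l ?powR_ge0//.
  rewrite -exprn_powR//.
  by apply: lerXn2r; rewrite ?nnegrE ?powR_ge0.
have bt : (3 / 5 * (1 + theta)) ^+ t <= (33 / 50) ^+ t by apply: lerXn2r; rewrite ?nnegrE.
apply: le_trans (ler_pM (powR_ge0 _ _) (exprn_ge0 _ B00) ms bt) _.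
have -> (a b e : R) : a * b ^+ t.+1 * e ^+ t = a * b * (b * e) ^+ t.
  by rewrite exprS exprMn !mulrA.
rewrite ler_wpM2l ?mulr_ge0 ?powR_ge0//.
by apply: lerXn2r; rewrite ?nnegrE.
Qed.

Section WalshOperator.
Variables (R : realType) (l t : nat) (c : 'I_l.+1 -> R).
Local Notation T := {ffun 'I_l -> bool}.
Hypotheses (c0 : forall k, 0 <= c k) (c1 : \sum_k c k = 1).

Definition rsign (b : bool) : R := (-1) ^+ b.

Definition walsh_kernel (w y : T) : R :=
  \sum_k c k * (rsign (rademacher k w) * rsign (rademacher k y)).

Definition walsh_power (w y : {ffun 'I_t -> T}) : R := \prod_j walsh_kernel (w j) (y j).

Lemma walsh_kernel_complex w y :
  combination (@rademacher l) c w y = ((walsh_kernel w y)%:C)%C.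
Proof.
rewrite rmorph_sum; apply: eq_bigr => k _; rewrite !rmorphM/=.
by rewrite /sign_kernel /sgn /rsign !rmorphXn !rmorphN !rmorph1.
Qed.

Lemma walsh_kernel_le1 w y : `|walsh_kernel w y| <= 1.
Proof.
rewrite -c1; apply: le_trans (ler_norm_sum _ _ _) _; apply: ler_sum => k _.
by rewrite /rsign -signr_addb normrM normr_sign mulr1 ger0_norm.
Qed.

Lemma walsh_kernel_diag w : walsh_kernel w w = 1.
Proof.
rewrite -c1; apply: eq_bigr => k _; rewrite /rsign -expr2 sqrr_sign mulr1 //.
Qed.

Lemma walsh_power_diag w : walsh_power w w = 1.
Proof. by rewrite /walsh_power big1// => j _; exact: walsh_kernel_diag. Qed.

(** Expanding the product over the coordinates gives one term of rank one for each
choice of a generator in every coordinate. *)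
Lemma walsh_power_decomposition : exists a b : 'I_(l.+1 ^ t) -> {ffun 'I_t -> T} -> R,
  forall w y, walsh_power w y = \sum_i a i w * b i y.
Proof.
have cardE : #|{ffun 'I_t -> 'I_l.+1}| = (l.+1 ^ t)%N by rewrite card_ffun !card_ord.
pose ix (i : 'I_(l.+1 ^ t)) : {ffun 'I_t -> 'I_l.+1} := enum_val (cast_ord (esym cardE) i).
exists (fun i w => \prod_j (c (ix i j) * rsign (rademacher (ix i j) (w j)))),
  (fun i y => \prod_j rsign (rademacher (ix i j) (y j))) => w y.
rewrite /walsh_power /walsh_kernel bigA_distr_bigA/=.
rewrite (reindex ix)/=; last first.
  apply: onW_bij; apply: (@bij_comp _ _ _ enum_val (cast_ord (esym cardE))).
    exact: enum_val_bij.
  by exists (cast_ord cardE) => i; [exact: cast_ordKV|exact: cast_ordK].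
by apply: eq_bigr => i _; rewrite -big_split/=; apply: eq_bigr => j _; rewrite mulrA.
Qed.

End WalshOperator.

Unset Implicit Arguments.

Theorem proposition4p1 (R : realType) (F : scalars) (p C : R)
    (hp1 : 1 < p) (hp2 : p != 2) (k : nat -> nat)
    (hk : forall s : nat, (0 < s)%N ->
      (0 < k s)%N /\
      forall (X Y : completeNormedModType (scalar_field R F))
             (u : {linear X -> Y}),
        bounded_operator u -> (exists x : X, u x != 0) -> rank_at_most s u ->
        (pi_summing p u < C%:E * pi_summing_m p (k s) u)%E) :
  forall K : R, (k s)%:R * s%:R `^ (- K) @[s --> \oo] --> +oo.
Proof.
move=> K; apply/cvgryPge => A0.
have a34 : 0 <= (3 / 4 : R) < 1 by apply/andP; split; lra.
have p0 : 0 < p by exact: lt_trans hp1.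
have p10 : 0 < p - 1 by rewrite subr_gt0.
pose q := p / (p - 1).
have q1 : 1 < q by rewrite /q ltr_pdivlMr// mul1r gtrBl.
have pq : p^-1 + q^-1 = 1.
  by rewrite /q invf_div mulrBl divff ?gt_eqF// mul1r addrC subrK.
(* Larger exponents and constants only strengthen the claim. *)
pose K1 := Num.max K 0; pose A1 := Num.max A0 1.
have K10 : 0 <= K1 by rewrite le_max lexx orbT.
have [l [s0 [l0 s01 hs1 hs2]]] := dimension_choice p0 K10.
have [c [J' [J'0 c0 c1 hJ']]] := interior_kernel hp1 q1 pq hp2 l.
pose J := J'.+1.
have J1 : (1 < J)%N by [].
have hJ (z : R[i]) : normc z <= J%:R^-1 -> factorable p q 1 (fun w y : {ffun 'I_l -> bool} =>
       (1 - z) * ((walsh_kernel c w y)%:C)%C + z * id_kernel R w y).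
  move=> zJ; have zJ' : normc z <= J'%:R^-1.
    by apply: le_trans zJ _; rewrite lef_pV2 ?posrE ?ltr0n// ler_nat.
  by apply: factorable_ext (hJ' z zJ') => w y; rewrite walsh_kernel_complex.
pose D : R := Num.max C 1.
have D0 : 0 < D by rewrite lt_max ltr01 orbT.
pose eta : R := (2 * D)^-1.
have eta0 : 0 < eta by rewrite invr_gt0 mulr_gt0.
have [d [dE d0]] : exists d : R, d = iter (8 * J) (@shrink R) eta /\ 0 < d.
  exists (iter (8 * J) (@shrink R) eta); split=> //.
  by elim: (8 * J)%N => //= n IH; rewrite /shrink exprn_gt0// divr_gt0.
have [t0 ht0] := @geometric_small R (3 / 4) (A1 `^ s0 * (11 / 10)) d a34 d0.
exists ((l.+1) ^ t0)%N => // s /= st; rewrite leNgt; apply/negP => small.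
have spos : (0 < s)%N by apply: leq_trans st; rewrite expn_gt0.
(* The largest tensor power of rank at most s; then s < (l+1)^(t+1), so that k s is
   at most A1 X^(t+1). *)
have [t [ts ts1 tt0]] : exists t, [/\ (l.+1 ^ t <= s)%N, (s < l.+1 ^ t.+1)%N & (t0 <= t)%N].
  have l1 : (1 < l.+1)%N by [].
  exists (trunc_log l.+1 s); have /andP[-> ->] := trunc_log_bounds l1 spos; split=> //.
  exact: trunc_log_max.
have [ks0 /(_ _ _ _)hu] := hk s spos.
set m := k s in ks0 hu small.
pose T := {ffun 'I_l -> bool}; pose Tt := {ffun 'I_t -> T}.
have cardT : #|T| = (2 ^ l)%N by rewrite card_ffun card_bool card_ord.
have T0 : (0 < #|T|)%N by rewrite cardT expn_gt0.
have Tt0 : (0 < #|Tt|)%N by rewrite card_ffun expn_gt0 T0.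
have sR : 1 <= s%:R :> R by rewrite ler1n.
pose X : R := l.+1%:R `^ K1.
have X0 : 0 <= X by exact: powR_ge0.
have A10 : 0 <= A1 by rewrite le_max ler01 orbT.
have mA : m%:R <= A1 * X ^+ t.+1.
  have h1 : m%:R * s%:R `^ (- K1) <= A1.
    apply: le_trans (_ : A0 <= _); last by rewrite le_max lexx.
    apply: le_trans (ltW small); rewrite ler_wpM2l// ler_powR// lerN2.
    by rewrite le_max lexx.
  rewrite powRN -ler_pdivlMr ?invr_gt0 ?powR_gt0 ?(lt_le_trans ltr01 sR)// invrK in h1.
  apply: le_trans h1 _; rewrite ler_wpM2l// /X -powR_mulrn ?powR_ge0// powRAC powR_mulrn//.
  rewrite ge0_ler_powR ?nnegrE ?exprn_ge0//.
  by rewrite -natrX ler_nat ltnW.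
have [s00 s0le1] := andP s01.
have small' : m%:R `^ s0 * (3 / 5 * (1 + (#|T|%:R `^ (- p^-1)) `^ s0)) ^+ t <= d.
  apply: le_trans (ht0 t tt0); rewrite cardT.
  exact: (polynomial_loses X0 A10 (ler0n R m) s00 (powR_ge0 _ _) mA hs1 hs2).
rewrite dE in small'.
have M1 : forall w : Tt, walsh_power c w w = 1 := walsh_power_diag c1.
pose u := @kernel_op R F Tt q q1 (walsh_power c).
have low := @pi_summing_kernel_ge R F Tt p q hp1 q1 pq (walsh_power c) M1 Tt0.
(* The factor 2 is the cost of passing to complex scalars, and eta = 1 / (2 D). *)
pose B : R := eta * 2 * (#|T|%:R ^+ t) `^ p^-1.
have TR : 0 < #|T|%:R :> R by rewrite ltr0n.
have B0 : 0 < B by rewrite !mulr_gt0// powR_gt0// exprn_gt0.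
have up : (pi_summing_m p m u <= B%:E)%E.
  apply: pi_summing_m_kernel_le => // W x W0 xW.
  have W20 : 0 <= 2 * W by rewrite mulr_ge0.
  have Phi1 (w y : T) : normc ((walsh_kernel c w y)%:C)%C <= 1.
    by rewrite normc_real walsh_kernel_le1.
  have := few_vectors_bound hp1 q1 pq J1 T0 Phi1 hJ ks0 W20 s01 (ltW eta0)
    (weakly_bounded_complex hp1 W0 xW) small'.
  have -> : eta * (#|T|%:R ^+ t) `^ p^-1 * (2 * W) = B * W by rewrite /B; ring.
  apply: le_trans; apply: ler_sum => i _.
  rewrite le_eqVlt; apply/orP; left; apply/eqP; congr (_ `^ _); congr sup_norm.
  apply/funext => w; rewrite to_complex_sum; congr normc; apply: eq_bigr => y _.
  by rewrite /walsh_power rmorph_prod.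
have [a [b ab]] := walsh_power_decomposition t c.
have := hu (lattice_space F (lq_lattice_norm Tt q1)) (lattice_space F (sup_lattice_norm R Tt)) u
  (kernel_op_bounded F q1 _) (kernel_op_neq0 F q1 M1 [ffun=> [ffun=> true]])
  (kernel_op_rank F q1 ts ab).
apply/negP; rewrite -leNgt.
have pi0 : (0 <= pi_summing_m p m u)%E.
  by apply: le_ereal_inf_tmp => _ [e [e0 _] <-]; rewrite lee_fin.
have CD : (C%:E <= D%:E)%E by rewrite lee_fin le_max lexx.
apply: le_trans (lee_wpmul2r pi0 CD) _.
apply: le_trans (lee_wpmul2l _ up) _; first by rewrite lee_fin ltW.
apply: le_trans low; rewrite -EFinM lee_fin card_ffun card_ord natrX /B /eta.
rewrite !mulrA le_eqVlt; apply/orP; left; apply/eqP.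
by rewrite invfM; field; rewrite gt_eqF.
Qed.
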